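(* Let $\mathcal B=\{n^{-s}\}_{n\ge1}$ be the canonical basis of the Hardy space of ordinary Dirichlet series $\mathcal H_p$, and let $\varphi_l^p,\varphi_u^p$ be its lower and upper democracy functions and $\varphi_{l,\mathcal E}^p,\varphi_{u,\mathcal E}^p$ its lower and upper super-democracy functions. Then: (a) If $p=1$: (i) $\varphi_l^1(N)\approx\varphi_{l,\mathcal E}^1(N)\approx\log(N)$ (for $N\ge 2$); (ii) $\varphi_u^1(N)\approx\varphi_{u,\mathcal E}^1(N)\approx N^{1/2}$. (b) If $1<p<\infty$: (i) $\varphi_l^p(N)\approx\varphi_{l,\mathcal E}^p(N)\approx N^{\min\{1/2,\,1/p'\}}$; (ii) $\varphi_u^p(N)\approx\varphi_{u,\mathcal E}^p(N)\approx N^{\max\{1/2,\,1/p'\}}$. (c) If $p=\infty$: (i) $\varphi_l^\infty(N)=N$ and $\varphi_{l,\mathcal E}^\infty(N)\approx N^{1/2}$; (ii) $\varphi_u^\infty(N)=\varphi_{u,\mathcal E}^\infty(N)=N$.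
   Context: A Dirichlet polynomial is a finite sum $D=\sum_{n\in A}a_n n^{-s}$, with $A\subset\mathbb N=\{1,2,\dots\}$ finite and $a_n\in\mathbb C$. Its norms are $\|D\|_{\mathcal H_p}=\big(\lim_{R\to\infty}\frac1{2R}\int_{-R}^R|\sum_{n\in A}a_n n^{-it}|^p\,dt\big)^{1/p}$ for $1\le p<\infty$ and $\|D\|_{\mathcal H_\infty}=\sup_{t\in\mathbb R}|\sum_{n\in A}a_n n^{-it}|$. For $1\le p<\infty$, $\mathcal H_p$ is the completion of the space of Dirichlet polynomials under $\|\cdot\|_{\mathcal H_p}$ (for $p=\infty$ only the norms of Dirichlet polynomials matter here; their closure in $\mathcal H_\infty$ is denoted $\mathcal A_\infty$). For a finite set $A\subset\mathbb N$ let $\mathcal E_A$ be the set of families $\varepsilon=(\varepsilon_n)_{n\in A}$ of complex numbers with $|\varepsilon_n|=1$. Put $\mathbf 1_{\varepsilon,A}=\sum_{n\in A}\varepsilon_n n^{-s}$ and $\mathbf 1_A=\sum_{n\in A}n^{-s}$ (empty sums are $0$). For $N\in\mathbb N$, with $A$ ranging over finite subsets of $\mathbb N$ and all norms taken in $\mathcal H_p$: $\varphi_u^p(N)=\sup\{\|\mathbf 1_A\|:|A|\le N\}$, $\varphi_l^p(N)=\inf\{\|\mathbf 1_A\|:|A|\ge N\}$, $\varphi_{u,\mathcal E}^p(N)=\sup\{\|\mathbf 1_{\varepsilon,A}\|:|A|\le N,\ \varepsilon\in\mathcal E_A\}$, $\varphi_{l,\mathcal E}^p(N)=\inf\{\|\mathbf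 1_{\varepsilon,A}\|:|A|\ge N,\ \varepsilon\in\mathcal E_A\}$. $p'$ is the conjugate exponent, $\frac1p+\frac1{p'}=1$. $f(N)\lesssim g(N)$ means that there is a constant $C>0$ independent of $N$ (possibly depending on $p$) with $f(N)\le C g(N)$ for all $N$; $f\approx g$ means $f\lesssim g$ and $g\lesssim f$. *)

(* Defs.v *)
From mathcomp Require Import all_boot all_order all_algebra.
From mathcomp Require Import finmap.
From mathcomp Require Import all_classical all_reals all_analysis.
From mathcomp Require Import complex.

Set Implicit Arguments.
Unset Strict Implicit.
Unset Printing Implicit Defensive.

Import Order.TTheory GRing.Theory Num.Theory.
Import numFieldNormedType.Exports.

Local Open Scope fset_scope.
Local Open Scope classical_set_scope.
Local Open Scope complex_scope.
Local Open Scope ring_scope.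

(* The modulus of a complex number, as a real number. *)
Notation cmod := ComplexField.Normc.normc.

(* n^{-it} = exp(- i t log n), for n >= 1. *)
Definition nat_pow_mit (R : realType) (n : nat) (t : R) : R[i] :=
  cos (t * ln n%:R) -i* sin (t * ln n%:R).

(* The value at s = it of the Dirichlet polynomial with frequency set A and
   coefficients a; only the values of a on A matter, and A is always
   required not to contain 0 below. *)
Definition dirichlet_poly (R : realType) (A : {fset nat}) (a : nat -> R[i])
    (t : R) : R[i] :=
  \sum_(n <- A) a n * nat_pow_mit n t.

(* The limit exists for every Dirichlet polynomial, by almost periodicity. *)
Definition Hnorm_fin (R : realType) (p : R) (A : {fset nat})
    (a : nat -> R[i]) : R :=
  lim ((2 * r)^-1 *
       (\int[lebesgue_measure]_(t in `[- r, r])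
          (cmod (dirichlet_poly A a t) `^ p)) @[r --> +oo]) `^ p^-1.

(* The set is nonempty and bounded by \sum_(n <- A) |a n|, so that this real
   supremum is the usual one. *)
Definition Hnorm_infty (R : realType) (A : {fset nat}) (a : nat -> R[i]) : R :=
  sup [set cmod (dirichlet_poly A a t) | t in [set: R]].

(* The norm of H_p, for 1 <= p <= +oo; the value at p = -oo is irrelevant. *)
Definition Hnorm (R : realType) (p : \bar R) (A : {fset nat})
    (a : nat -> R[i]) : R :=
  match p with
  | r%:E => Hnorm_fin r A a
  | +oo%E => Hnorm_infty A a
  | -oo%E => 0
  end.

Definition unimodular_on (R : realType) (A : {fset nat}) (e : nat -> R[i]) :=
  forall n, n \in A -> cmod (e n) = 1.

(* The sets below are nonempty and bounded (below by 0; above by N for the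
   upper functions), so that the real sup and inf are the usual ones. *)
Definition phi_u (R : realType) (p : \bar R) (N : nat) : R :=
  sup [set x | exists A : {fset nat},
    [/\ 0%N \notin A, (#|` A| <= N)%N & x = Hnorm p A (fun=> 1)]].
Arguments phi_u R p N : clear implicits.

Definition phi_l (R : realType) (p : \bar R) (N : nat) : R :=
  inf [set x | exists A : {fset nat},
    [/\ 0%N \notin A, (N <= #|` A|)%N & x = Hnorm p A (fun=> 1)]].
Arguments phi_l R p N : clear implicits.

Definition phi_uE (R : realType) (p : \bar R) (N : nat) : R :=
  sup [set x | exists (A : {fset nat}) (e : nat -> R[i]),
    [/\ 0%N \notin A, (#|` A| <= N)%N, unimodular_on A e & x = Hnorm p A e]].
Arguments phi_uE R p N : clear implicits.

Definition phi_lE (R : realType) (p : \bar R) (N : nat) : R :=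
  inf [set x | exists (A : {fset nat}) (e : nat -> R[i]),
    [/\ 0%N \notin A, (N <= #|` A|)%N, unimodular_on A e & x = Hnorm p A e]].
Arguments phi_lE R p N : clear implicits.

(* The comparison is required for all N >= N0, with N0 fixed in advance: it is
   not merely asymptotic. *)
Definition lesssim_from (R : realType) (N0 : nat) (f g : nat -> R) : Prop :=
  exists2 C : R, 0 < C & forall N : nat, (N0 <= N)%N -> f N <= C * g N.

Definition approx_from (R : realType) (N0 : nat) (f g : nat -> R) : Prop :=
  lesssim_from N0 f g /\ lesssim_from N0 g f.

(* Main.v *)
Require Import Defs.
From mathcomp Require Import all_boot all_order all_algebra.
From mathcomp Require Import finmap.
From mathcomp Require Import all_classical all_reals all_analysis.
From mathcomp Require Import complex.
From mathcomp Require Import ring lra zify.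

(** Write M(g) for the limit of the averages of g over [-r, r].  Trigonometric
polynomials have such a mean value, and |f|^p = (|f|^2)^(p/2) is a uniform
limit of polynomials in the trigonometric polynomial |f|^2, so the limit that
defines the H_p norm exists ([has_mean_cmod_powR]).  If the coefficients on A
are unimodular, then M(|f|^2) is the cardinal of A.  From here on every
estimate is a pointwise inequality between functions whose means are known,
followed by the monotonicity of M.

Bounds valid for all sets.  For unimodular coefficients on a set of N elements,
M(|f|^2) = N and |f| <= N.  Bernoulli's inequality for (|f|^2/N)^(p/2) bounds
the norm by N^(1/2), and |f|^2 = |f|^p |f|^(2-p) bounds it by N^(1/p'); the
former is an upper and the latter a lower bound if p <= 2, and conversely if
p >= 2.

The case p = 1 of the lower bound is Littlewood's inequality
M(|f|) >= c log N ([littlewood_lower_bound]), proved by the method of McGehee,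
Pigno and Smith: f is tested against a bounded trigonometric polynomial built
from averages f_j of f over successive blocks of 4^j frequencies, each of which
is damped by the later ones through a factor with nonpositive spectrum
([multiplier]).  Because this spectrum is nonpositive, damping does not affect
the pairing with frequencies above the block, and its effect below is
controlled in the mean square.

Extremal sets.  They consist of powers of 2, so that everything is a function
of z = 2^(-it).  The exponents 0, ..., 2^m - 1 give the Dirichlet kernel D.
Its p-th power is dominated by a sum over dyadic scales of multiples of Fejer
kernels |D_(2^j)|^2 ([dker_powR_le]); hence the norms are of order log N for
p = 1 and N^(1/p') for p > 1.  The exponents 3^k behave like independent
variables: the means of exp(c Re f) are bounded by those of Riesz products,
whence all norms are of order N^(1/2) ([mean_lac_le]).  The matching lower
bounds for these two families interpolate the exponent 2 between p and an
exponent already treated ([sqr_le_split]).  Rudin-Shapiro signs give sup norm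
of order N^(1/2) ([rudin_shapiro]). *)

Import Order.TTheory GRing.Theory Num.Theory.
Import numFieldNormedType.Exports.
Import ComplexField.Normc.

Set Implicit Arguments.
Unset Strict Implicit.
Unset Printing Implicit Defensive.

Local Open Scope ring_scope.
Local Open Scope classical_set_scope.
Local Open Scope complex_scope.

(** * Mean values *)

Section Mean.
Variable R : realType.
Implicit Types (g h : R -> R) (m : R).

Definition cesaro g (r : R) : R :=
  (2 * r)^-1 * \int[lebesgue_measure]_(t in `[- r, r]) g t.

(** Continuity is bundled with the limit: it makes all the integrals over
[-r, r] finite, so that means are linear and monotone unconditionally. *)
Definition has_mean g m :=
  continuous g /\ (cesaro g r @[r --> +oo] --> m).

Lemma cont_integrable g (a b : R) : continuous g ->
  (@lebesgue_measure R).-integrable `[a, b] (EFin \o g).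
Proof.
move=> cg; apply: continuous_compact_integrable; first exact: segment_compact.
by apply: continuous_subspaceT.
Qed.

Lemma cesaro_cst m (r : R) : 0 < r -> cesaro (fun=> m) r = m.
Proof.
move=> r0; rewrite /cesaro Rintegral_cst//= lebesgue_measure_itv/= lte_fin.
have -> : - r < r by lra.
by rewrite -EFinD /= opprK; field; rewrite gt_eqF.
Qed.

Lemma cesaroD g h (r : R) : continuous g -> continuous h ->
  cesaro (fun t => g t + h t) r = cesaro g r + cesaro h r.
Proof.
move=> cg ch; rewrite /cesaro RintegralD ?mulrDr//; exact: cont_integrable.
Qed.

Lemma cesaroZ g c (r : R) : continuous g ->
  cesaro (fun t => c * g t) r = c * cesaro g r.
Proof.
move=> cg; rewrite /cesaro RintegralZl//; last exact: cont_integrable.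
by rewrite mulrCA.
Qed.

Lemma le_cesaro g h (r : R) : 0 < r -> continuous g -> continuous h ->
  (forall t, g t <= h t) -> cesaro g r <= cesaro h r.
Proof.
move=> r0 cg ch gh; rewrite /cesaro ler_pM2l ?invr_gt0 ?mulr_gt0//.
by apply: le_Rintegral => //; exact: cont_integrable.
Qed.

Lemma has_mean_cst m : has_mean (fun=> m) m.
Proof.
split; first by move=> x; exact: cvg_cst.
apply: cvg_near_cst; near=> r; apply: cesaro_cst.
near: r; exact: nbhs_pinfty_gt.
Unshelve. all: by end_near. Qed.

Lemma has_meanD g h m1 m2 : has_mean g m1 -> has_mean h m2 ->
  has_mean (fun t => g t + h t) (m1 + m2).
Proof.
move=> [cg hg] [ch hh]; split; first by move=> x; apply: cvgD; [exact: cg|exact: ch].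
under eq_fun do rewrite cesaroD//.
exact: cvgD.
Qed.

Lemma has_meanZ g c m : has_mean g m -> has_mean (fun t => c * g t) (c * m).
Proof.
move=> [cg hg]; split; first by move=> x; apply: cvgM; [exact: cvg_cst|exact: cg].
under eq_fun do rewrite cesaroZ//.
apply: cvgM => //; exact: cvg_cst.
Qed.

Lemma has_meanN g m : has_mean g m -> has_mean (fun t => - g t) (- m).
Proof.
by move=> /(has_meanZ (-1)); rewrite mulN1r; under eq_fun do rewrite mulN1r.
Qed.

Lemma has_meanB g h m1 m2 : has_mean g m1 -> has_mean h m2 ->
  has_mean (fun t => g t - h t) (m1 - m2).
Proof. by move=> hg /has_meanN; exact: has_meanD. Qed.

Lemma has_mean_sum (I : Type) (s : seq I) (g : I -> R -> R) (m : I -> R) :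
  (forall i, has_mean (g i) (m i)) ->
  has_mean (fun t => \sum_(i <- s) g i t) (\sum_(i <- s) m i).
Proof.
move=> H; elim: s => [|i s IH].
  by rewrite big_nil; under eq_fun do rewrite big_nil; exact: has_mean_cst.
by rewrite big_cons; under eq_fun do rewrite big_cons; exact: has_meanD.
Qed.

Lemma le_has_mean g h m1 m2 : has_mean g m1 -> has_mean h m2 ->
  (forall t, g t <= h t) -> m1 <= m2.
Proof.
move=> [cg hg] [ch hh] gh.
apply: (ler_cvg_to hg hh).
by apply: filterS (nbhs_pinfty_gt (num_real 0)) => r r0; apply: le_cesaro.
Qed.

(** If |g - h| <= e everywhere, then the averages of g and h over any interval
differ by at most e; so the averages of g satisfy the Cauchy criterion. *)
Lemma has_mean_uniform g :
  (forall e : R, 0 < e -> exists h m, has_mean h m /\ forall t, `|g t - h t| <= e) ->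
  exists m, has_mean g m.
Proof.
move=> H.
have cg : continuous g.
  move=> x; apply/cvgrPdist_le => e e0.
  have e30 : 0 < e / 3 by rewrite divr_gt0.
  have [h [m [[ch _] gh]]] := H _ e30.
  have := ch x => /cvgrPdist_le /(_ _ e30).
  apply: filterS => y hy.
  have -> : g x - g y = (g x - h x) + (h x - h y) - (g y - h y) by ring.
  apply: le_trans (ler_normB _ _) _.
  apply: le_trans (lerD (ler_normD _ _) (lexx _)) _.
  by have := gh x; have := gh y; lra.
suff : cvg (cesaro g r @[r --> +oo]) by move=> /cvg_ex[m hm]; exists m.
apply/cauchy_cvgP; apply: cauchy_exP => e e0.
have e30 : 0 < e / 3 by rewrite divr_gt0.
have [h [m [[ch hm] gh]]] := H _ e30.
exists m; move: hm => /cvgrPdist_le /(_ _ e30) hm.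
change (\forall r \near +oo, ball m e (cesaro g r)).
apply: (filterS2 _ _ (nbhs_pinfty_gt (num_real 0)) hm) => r r0 h1.
have h2 : cesaro g r <= cesaro h r + e / 3.
  rewrite -[X in _ <= _ + X](@cesaro_cst _ r)// -cesaroD//; last by move=> x; exact: cvg_cst.
  apply: le_cesaro => //.
    by move=> x; apply: cvgD; [exact: ch|exact: cvg_cst].
  by move=> t; have := gh t; rewrite ler_norml; lra.
have h3 : cesaro h r <= cesaro g r + e / 3.
  rewrite -[X in _ <= _ + X](@cesaro_cst _ r)// -cesaroD//; last by move=> x; exact: cvg_cst.
  apply: le_cesaro => //.
    by move=> x; apply: cvgD; [exact: cg|exact: cvg_cst].
  by move=> t; have := gh t; rewrite ler_norml; lra.
rewrite /ball/= ltr_norml; move: h1; rewrite ler_norml => h1.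
by apply/andP; split; lra.
Qed.

(** The integral over [-r, r] stays bounded while it is divided by 2r. *)
Lemma has_mean_bounded_primitive g (F : R -> R) (B : R) :
  continuous g -> (forall t, is_derive t (1:R) F (g t)) ->
  (forall t, `|F t| <= B) -> has_mean g 0.
Proof.
move=> cg dF FB; split=> //.
apply/cvgrPdist_le => e e0; near=> r.
have r0 : 0 < r by near: r; exact: nbhs_pinfty_gt.
rewrite sub0r normrN /cesaro /Rintegral.
have cF : continuous F.
  move=> x; apply: differentiable_continuous; apply/derivable1_diffP.
  by have := dF x => /@ex_derive.
rewrite (@continuous_FTC2 _ _ F) //=; last first.
- by move=> t _; rewrite derive1E; apply: derive_val.
- split; [by move=> t _; exact: ex_derive| |].
  + exact/cvg_at_right_filter/cF.
  + exact/cvg_at_left_filter/cF.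
- exact: continuous_subspaceT.
- lra.
rewrite normrM gtr0_norm ?invr_gt0 ?mulr_gt0//=.
apply: (@le_trans _ _ ((2 * r)^-1 * (2 * B))).
  rewrite ler_pM2l ?invr_gt0 ?mulr_gt0//.
  apply: le_trans (ler_normB _ _) _; have := FB r; have := FB (- r); lra.
have rB : B / e <= r by near: r; apply: nbhs_pinfty_ge; exact: num_real.
rewrite ler_pdivrMl ?mulr_gt0//.
by move: rB; rewrite ler_pdivrMr//; lra.
Unshelve. all: by end_near. Qed.

Lemma has_mean_cos_sin (a b l : R) : l != 0 ->
  has_mean (fun t => a * cos (l * t) + b * sin (l * t)) 0.
Proof.
move=> l0.
pose F t := l^-1 * (a * sin (l * t) - b * cos (l * t)).
have dl t : is_derive t (1:R) ( *%R l) l.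
  have H : is_derive t (1:R) (l \*: (id : R -> R^o)) (l *: (1 : R^o)).
    exact: is_deriveZ.
  by apply: is_derive_eq H _; rewrite /GRing.scale/= mulr1.
apply: (@has_mean_bounded_primitive _ F (`|l^-1| * (`|a| + `|b|))).
- move=> t; apply: cvgD; apply: cvgM; try exact: cvg_cst.
    apply: (@continuous_comp _ _ _ ( *%R l) cos); first exact: mulrl_continuous.
    exact: continuous_cos.
  apply: (@continuous_comp _ _ _ ( *%R l) sin); first exact: mulrl_continuous.
  exact: continuous_sin.
- move=> t.
  have ds : is_derive t (1:R) (sin \o ( *%R l)) (cos (l * t) * l).
    exact: is_derive1_comp.
  have dc : is_derive t (1:R) (cos \o ( *%R l)) (- sin (l * t) * l).
    exact: is_derive1_comp.
  have H : is_derive t (1:R) (l^-1 \*: (a \*: (sin \o ( *%R l) : R -> R^o) -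
      b \*: (cos \o ( *%R l) : R -> R^o)))
      (l^-1 *: (a *: (cos (l * t) * l : R^o) - b *: (- sin (l * t) * l : R^o))).
    by apply: is_deriveZ; apply: is_deriveB; exact: is_deriveZ.
  by apply: is_derive_eq H _; rewrite /GRing.scale/=; field.
- move=> t; rewrite /F normrM ler_wpM2l//.
  apply: le_trans (ler_normB _ _) _; rewrite !normrM.
  apply: lerD; rewrite ler_piMr//.
    by rewrite ler_norml sin_geN1 sin_le1.
  by rewrite ler_norml cos_geN1 cos_le1.
Qed.

End Mean.

(** * Trigonometric polynomials with prescribed frequencies *)

Section Trig.
Variable R : realType.
Local Notation Re := (@complex.Re R).
Local Notation Im := (@complex.Im R).
Implicit Types (P Q S : R -> Prop) (f g : R -> R[i]) (z w : R[i]).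

(** Unlike the modulus, its square is a trigonometric polynomial whenever the
function is one. *)
Definition csq z : R := Re z ^+ 2 + Im z ^+ 2.

Lemma csq_ge0 z : 0 <= csq z. Proof. by rewrite addr_ge0// sqr_ge0. Qed.

Lemma cmodE z : cmod z = Num.sqrt (csq z). Proof. by case: z. Qed.

Lemma cmod_ge0 z : 0 <= cmod z. Proof. by rewrite cmodE sqrtr_ge0. Qed.

Lemma sqr_cmod z : cmod z ^+ 2 = csq z.
Proof. by rewrite cmodE sqr_sqrtr// csq_ge0. Qed.

Lemma csqM z w : csq (z * w) = csq z * csq w.
Proof. by case: z w => [a b] [c d]; rewrite /csq /=; ring. Qed.

Lemma csqD z w : csq (z + w) = csq z + csq w + 2 * Re (z * w^*).
Proof. by case: z w => [a b] [c d]; rewrite /csq /=; ring. Qed.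

Lemma csqE z : csq z = Re (z * z^*).
Proof. by case: z => [a b]; rewrite /csq /=; ring. Qed.

Lemma cmod_conj z : cmod z^* = cmod z.
Proof. by rewrite !cmodE; case: z => [a b]; rewrite /csq /= sqrrN. Qed.

Lemma cmod_real (x : R) : cmod x%:C = `|x|.
Proof. by rewrite cmodE /csq /= expr0n addr0 sqrtr_sqr. Qed.

Lemma cmodX z n : cmod (z ^+ n) = cmod z ^+ n.
Proof.
elim: n => [|n IH]; first by rewrite !expr0 normc1.
by rewrite !exprS normcM IH.
Qed.

Lemma ReM_conj_le z w : Re (z * w^*) <= cmod z * cmod w.
Proof.
rewrite -(cmod_conj w) -normcM cmodE.
apply: le_trans (ler_norm _) _; rewrite -sqrtr_sqr ler_sqrt ?csq_ge0//.
by rewrite /csq lerDl sqr_ge0.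
Qed.

Lemma cmod_sum_le (I : Type) (s : seq I) (Pr : pred I) (F : I -> R[i]) :
  cmod (\sum_(i <- s | Pr i) F i) <= \sum_(i <- s | Pr i) cmod (F i).
Proof.
elim/big_rec2: _ => [|i x y _ H]; first by rewrite normc0.
by apply: le_trans (le_normcD _ _) _; rewrite lerD2l.
Qed.

Lemma ReD z w : Re (z + w) = Re z + Re w. Proof. by case: z w => [? ?] []. Qed.
Lemma ReN z : Re (- z) = - Re z. Proof. by case: z. Qed.
Lemma Re_sum (I : Type) (s : seq I) (Pr : pred I) (F : I -> R[i]) :
  Re (\sum_(i <- s | Pr i) F i) = \sum_(i <- s | Pr i) Re (F i).
Proof. by elim/big_rec2: _ => // i x y _ <-; rewrite ReD. Qed.
Lemma ReZ (x : R) z : Re (x%:C * z) = x * Re z.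
Proof. by case: z => a b /=; ring. Qed.

Definition cis (x : R) : R[i] := cos x +i* sin x.

Lemma cisD x y : cis (x + y) = cis x * cis y.
Proof.
rewrite /cis cosD sinD; apply/eqP; rewrite eq_complex/=.
by apply/andP; split; apply/eqP; ring.
Qed.

Lemma cisN x : cis (- x) = (cis x)^*.
Proof. by rewrite /cis cosN sinN. Qed.

Lemma cis0 : cis 0 = 1. Proof. by rewrite /cis cos0 sin0. Qed.

Lemma csq_cis x : csq (cis x) = 1.
Proof. by rewrite /csq /= cos2Dsin2. Qed.

Lemma cmod_cis x : cmod (cis x) = 1.
Proof. by rewrite cmodE csq_cis sqrtr1. Qed.

Lemma cisX x n : cis x ^+ n = cis (n%:R * x).
Proof.
elim: n => [|n IH]; first by rewrite expr0 mul0r cis0.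
by rewrite exprS IH -cisD -add1n natrD mulrDl mul1r.
Qed.

(** The predicate P constrains the frequencies.  Being generated by characters
and sums, the class is closed under products and conjugation by induction, and
no list of coefficients has to be normalised: for a function with no zero
frequency in P the mean vanishes, which is all that orthogonality amounts to. *)
Inductive trig P : (R -> R[i]) -> Prop :=
| trig0 : trig P (fun=> 0)
| trig_char c l : P l -> trig P (fun t => c * cis (l * t))
| trigD f g : trig P f -> trig P g -> trig P (fun t => f t + g t).

Lemma trig_sub P Q f : (forall l, P l -> Q l) -> trig P f -> trig Q f.
Proof.
move=> PQ; elim=> [|c l Pl|f1 f2 _ h1 _ h2]; [exact: trig0| |exact: trigD].
by apply: trig_char; exact: PQ.
Qed.

Lemma trig_sum (I : eqType) P (s : seq I) (F : I -> R -> R[i]) :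
  (forall i, i \in s -> trig P (F i)) -> trig P (fun t => \sum_(i <- s) F i t).
Proof.
elim: s => [|i s IH] H.
  by under eq_fun do rewrite big_nil; exact: trig0.
under eq_fun do rewrite big_cons; apply: trigD.
  by apply: H; rewrite mem_head.
by apply: IH => j js; apply: H; rewrite inE js orbT.
Qed.

Lemma trig_cst P c : P 0 -> trig P (fun=> c).
Proof.
move=> P0; have := trig_char c P0; congr (trig P _).
by apply/funext => t; rewrite mul0r cis0 mulr1.
Qed.

Lemma trigM P Q S f g : (forall x y, P x -> Q y -> S (x + y)) ->
  trig P f -> trig Q g -> trig S (fun t => f t * g t).
Proof.
move=> PQS hf hg; elim: hf => [|c l Pl|f1 f2 _ h1 _ h2].
- by under eq_fun do rewrite mul0r; exact: trig0.
- elim: hg => [|d k Qk|g1 g2 _ h1 _ h2].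
  + by under eq_fun do rewrite mulr0; exact: trig0.
  + have := trig_char (c * d) (PQS _ _ Pl Qk); congr (trig S _).
    by apply/funext => t; rewrite mulrDl cisD; ring.
  + by under eq_fun do rewrite mulrDr; exact: trigD.
- by under eq_fun do rewrite mulrDl; exact: trigD.
Qed.

Lemma trigZ P c f : trig P f -> trig P (fun t => c * f t).
Proof.
apply: (@trigM (eq 0)); last exact: trig_cst.
by move=> x y <-; rewrite add0r.
Qed.

Lemma trigN P f : trig P f -> trig P (fun t => - f t).
Proof. by move=> /(trigZ (-1)); under eq_fun do rewrite mulN1r. Qed.

Lemma trig_conj P f : trig P f -> trig (fun l => P (- l)) (fun t => (f t)^*).
Proof.
elim=> [|c l Pl|f1 f2 _ h1 _ h2].
- rewrite (_ : (fun _ => _) = fun=> 0); first exact: trig0.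
  by apply/funext => t; rewrite /= oppr0.
- have Pl' : P (- - l) by rewrite opprK.
  have := @trig_char (fun l => P (- l)) c^* (- l) Pl'; congr (trig _ _).
  by apply/funext => t; rewrite rmorphM/= mulNr cisN.
- rewrite (_ : (fun _ => _) = fun t => (f1 t)^* + (f2 t)^*); first exact: trigD.
  by apply/funext => t; rewrite rmorphD.
Qed.

Lemma trigX P f n : P 0 -> (forall x y, P x -> P y -> P (x + y)) ->
  trig P f -> trig P (fun t => f t ^+ n).
Proof.
move=> P0 PD hf; elim: n => [|n IH].
  by under eq_fun do rewrite expr0; exact: trig_cst.
by under eq_fun do rewrite exprS; exact: trigM hf IH.
Qed.

Lemma trig_prod (I : eqType) P (s : seq I) (F : I -> R -> R[i]) :
  P 0 -> (forall x y, P x -> P y -> P (x + y)) ->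
  (forall i, i \in s -> trig P (F i)) -> trig P (fun t => \prod_(i <- s) F i t).
Proof.
move=> P0 PD; elim: s => [|i s IH] H.
  by under eq_fun do rewrite big_nil; exact: trig_cst.
under eq_fun do rewrite big_cons; apply: (trigM PD).
  by apply: H; rewrite mem_head.
by apply: IH => j js; apply: H; rewrite inE js orbT.
Qed.

Definition trigT := trig (fun=> True).

Lemma trig_trigT P f : trig P f -> trigT f.
Proof. exact: trig_sub. Qed.

Lemma trigT_Re f : trigT f -> trigT (fun t => (Re (f t))%:C).
Proof.
move=> hf; have : trigT (fun t => (2^-1)%:C * (f t + (f t)^*)).
  by apply: trigZ; apply: trigD => //; exact: trig_conj hf.
congr (trig _ _); apply/funext => t.
by case: (f t) => a b; apply/eqP; rewrite eq_complex/=; apply/andP; split; apply/eqP; lra.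
Qed.

Lemma trigT_csq f : trigT f -> trigT (fun t => (csq (f t))%:C).
Proof.
move=> hf; under eq_fun do rewrite csqE; apply: trigT_Re.
by apply: trigM hf (trig_conj hf).
Qed.

Lemma trigT_horner (p : {poly R}) (g : R -> R) :
  trigT (fun t => (g t)%:C) -> trigT (fun t => (p.[g t])%:C).
Proof.
move=> hg; elim/poly_ind: p => [|p c IH].
  by under eq_fun do rewrite horner0; exact: trig0.
rewrite (_ : (fun _ => _) = fun t => p.[g t]%:C * (g t)%:C + c%:C).
  by apply: trigD; [exact: trigM IH hg|exact: trig_cst].
by apply/funext => t; rewrite hornerMXaddC rmorphD rmorphM.
Qed.

Lemma trig_bounded f : trigT f -> exists2 B : R, 0 <= B & forall t, cmod (f t) <= B.
Proof.
elim=> [|c l _|f1 f2 _ [B1 ? h1] _ [B2 ? h2]].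
- by exists 0 => // t; rewrite normc0.
- exists (cmod c); rewrite ?cmod_ge0// => t.
  by rewrite normcM cmod_cis mulr1.
- exists (B1 + B2); rewrite ?addr_ge0// => t.
  by apply: le_trans (le_normcD _ _) _; exact: lerD.
Qed.

Lemma Re_char c (x : R) : Re (c * cis x) = Re c * cos x + (- Im c) * sin x.
Proof. by case: c => a b /=; ring. Qed.

Lemma trig_mean0 P f : trig P f -> ~ P 0 -> has_mean (fun t => Re (f t)) 0.
Proof.
move=> hf P0; elim: hf => [|c l Pl|f1 f2 _ h1 _ h2].
- exact: has_mean_cst.
- under eq_fun do rewrite Re_char; apply: has_mean_cos_sin.
  by apply/eqP => l0; apply: P0; rewrite -l0.
- by under eq_fun do rewrite ReD; rewrite -[X in has_mean _ X]addr0; exact: has_meanD.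
Qed.

Lemma trig_has_mean f : trigT f -> exists m, has_mean (fun t => Re (f t)) m.
Proof.
elim=> [|c l _|f1 f2 _ [m1 h1] _ [m2 h2]].
- by exists 0; exact: has_mean_cst.
- have [->|l0] := eqVneq l 0.
    exists (Re c); under eq_fun do rewrite mul0r cis0 mulr1; exact: has_mean_cst.
  by exists 0; under eq_fun do rewrite Re_char; exact: has_mean_cos_sin.
- by exists (m1 + m2); under eq_fun do rewrite ReD; exact: has_meanD.
Qed.

Lemma trig_has_mean_real (g : R -> R) : trigT (fun t => (g t)%:C) ->
  exists m, has_mean g m.
Proof. by move=> /trig_has_mean. Qed.

(** Parseval: splitting off one term, the cross terms have frequencies
l i - l j <> 0, hence mean zero. *)
Lemma mean_csq_unimodular (I : eqType) (s : seq I) (l : I -> R) (a : I -> R[i]) :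
  uniq s -> {in s &, injective l} -> (forall i, i \in s -> cmod (a i) = 1) ->
  has_mean (fun t => csq (\sum_(i <- s) a i * cis (l i * t))) (size s)%:R.
Proof.
elim: s => [|i s IH] /=; first move=> *.
  under eq_fun do rewrite big_nil /csq/= expr0n addr0.
  exact: has_mean_cst.
move=> /andP[iNs us] linj a1.
under eq_fun do rewrite big_cons csqD csqM -sqr_cmod a1 ?mem_head// csq_cis expr1n mulr1.
rewrite -[X in has_mean _ X]natr1 [X in has_mean _ X]addrC -[X in has_mean _ X]addr0.
apply: has_meanD.
  apply: has_meanD; first exact: has_mean_cst.
  apply: IH => //.
    by move=> x y xs ys; apply: linj; rewrite inE ?xs ?ys orbT.
  by move=> j js; apply: a1; rewrite inE js orbT.
rewrite -[X in has_mean _ X](mulr0 2); apply: has_meanZ.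
apply: (@trig_mean0 (fun x => exists2 j, j \in s & x = l i - l j)); last first.
  move=> [j js] /eqP; rewrite eq_sym subr_eq0 => /eqP /linj; rewrite mem_head inE js orbT.
  by move=> /(_ erefl erefl) ij; move: iNs; rewrite ij js.
apply: (@trigM (eq (l i)) (fun x => exists2 j, j \in s & - x = l j)).
- by move=> x y <- [j js e]; exists j => //; rewrite -e opprK.
- exact: (@trig_char (eq (l i)) (a i) (l i) erefl).
- apply: (@trig_conj (fun x => exists2 j, j \in s & x = l j)); apply: trig_sum => j js.
  by apply: trig_char; exists j.
Qed.

End Trig.

(** * Polynomial approximation of powers, and existence of the norms *)

Section Weierstrass.
Variable R : realType.
Implicit Types (a x y : R) (phi psi : nat -> R).

(** Both Bernoulli inequalities are the inequality of Young
x y <= x^p / p + y^q / q with y = 1. *)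
Lemma powR_bernoulli_le a x : 0 < a -> a <= 1 -> 0 <= x ->
  x `^ a <= 1 + a * (x - 1).
Proof.
move=> a0; rewrite le_eqVlt => /predU1P[->|a1] x0.
  by rewrite powRr1//; lra.
have := @conjugate_powR R (x `^ a) 1 a^-1 (1 - a)^-1 (powR_ge0 _ _) ler01.
rewrite !invr_gt0 subr_gt0 !invrK powR1 mulr1 -powRrM mulfV ?gt_eqF// powRr1//.
by move=> /(_ a0 a1 (subrKC _ _)); lra.
Qed.

Lemma powR_bernoulli_ge a x : 1 <= a -> 0 <= x ->
  1 + a * (x - 1) <= x `^ a.
Proof.
rewrite le_eqVlt => /predU1P[<-|a1] x0.
  by rewrite powRr1//; lra.
have a0 : 0 < a by lra.
have b0 : 0 < 1 - a^-1 by rewrite subr_gt0 invf_lt1.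
have := @conjugate_powR R x 1 a (1 - a^-1)^-1 x0 ler01 a0.
rewrite invr_gt0 => /(_ b0); rewrite invrK powR1 mulr1 => /(_ (subrKC _ _)).
rewrite mul1r => H.
have : a * x <= a * (x `^ a / a + (1 - a^-1)) by rewrite ler_pM2l.
have -> : a * (x `^ a / a + (1 - a^-1)) = x `^ a + a - 1 by field; rewrite gt_eqF.
lra.
Qed.

(** A quadratic modulus of continuity is what the variance of the Bernstein
operator can be combined with.  Away from 0 the power is Lipschitz, by
Bernoulli, and s d <= e + s^2 d^2 / (4 e). *)
Lemma powR_modulus a (e : R) : 0 < a -> 0 < e -> exists2 K : R, 0 <= K &
  forall x y, 0 <= x <= 1 -> 0 <= y <= 1 ->
  `|x `^ a - y `^ a| <= e + K * (x - y) ^+ 2.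
Proof.
move=> a0 e0.
(* below r the power is at most e; above r its Lipschitz constant is at most
   b / r *)
pose r := e `^ a^-1; pose b := Num.max 1 a.
have r0 : 0 < r by rewrite powR_gt0.
have b0 : 0 <= b by rewrite le_max ler01.
exists ((b / r) ^+ 2 / (4 * e)); first by rewrite divr_ge0 ?sqr_ge0// mulr_ge0// ltW.
have main x y : 0 <= y -> y <= x -> x <= 1 ->
    `|x `^ a - y `^ a| <= e + (b / r) ^+ 2 / (4 * e) * (x - y) ^+ 2.
  move=> y0 yx x1; have x0 := le_trans y0 yx.
  have yxa : y `^ a <= x `^ a by apply: ge0_ler_powR => //; exact: ltW.
  rewrite ger0_norm ?subr_ge0//.
  have K0 : 0 <= (b / r) ^+ 2 / (4 * e) * (x - y) ^+ 2.
    by rewrite mulr_ge0 ?sqr_ge0// divr_ge0 ?sqr_ge0// mulr_ge0// ltW.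
  have [xe|xe] := lerP (x `^ a) e.
    by have := powR_ge0 y a; lra.
  have xr : r <= x.
    rewrite -(powRr1 x0) -(mulfV (lt0r_neq0 a0)) powRrM.
    apply: ge0_ler_powR; rewrite ?nnegrE ?powR_ge0 ?invr_ge0 ?ltW//.
  have xp : 0 < x by exact: lt_le_trans xr.
  pose u := y / x.
  have u0 : 0 <= u by rewrite divr_ge0.
  have u1 : u <= 1 by rewrite ler_pdivrMr// mul1r.
  have yE : y = u * x by rewrite /u mulfVK// gt_eqF.
  have ub : 1 - b * (1 - u) <= u `^ a.
    have [a1|a1] := lerP 1 a.
      apply: le_trans (powR_bernoulli_ge a1 u0).
      by rewrite /b (max_idPr a1); lra.
    rewrite /b (max_idPl (ltW a1)).
    have [->|un0] := eqVneq u 0; first by rewrite powR0 ?gt_eqF//; lra.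
    have := @ger1_powR R u a; rewrite lt0r un0 u0 u1 => /(_ isT (ltW a1)); lra.
  have d0 : 0 <= x - y by rewrite subr_ge0.
  have xa1 : x `^ a <= 1.
    by rewrite -(powRr0 x); apply: ger_powR; rewrite ?xp// ltW.
  apply: (@le_trans _ _ (b / r * (x - y))).
    have -> : x `^ a - y `^ a = x `^ a * (1 - u `^ a) by rewrite yE powRM//; ring.
    apply: (@le_trans _ _ (1 * (b * (1 - u)))).
      apply: ler_pM; rewrite ?powR_ge0//; last by lra.
      rewrite subr_ge0; have -> : 1 = 1 `^ a :> R by rewrite powR1.
      by apply: ge0_ler_powR => //; rewrite ?nnegrE ?powR1// ltW.
    rewrite mul1r -mulrA ler_wpM2l// ler_pdivlMl//.
    apply: (@le_trans _ _ (x * (1 - u))); first by rewrite ler_wpM2r// subr_ge0.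
    by rewrite mulrBr mulr1 mulrC -yE.
  rewrite -subr_ge0.
  have -> : e + (b / r) ^+ 2 / (4 * e) * (x - y) ^+ 2 - b / r * (x - y) =
     (2 * e - b / r * (x - y)) ^+ 2 / (4 * e) by field; rewrite !gt_eqF.
  by rewrite divr_ge0 ?sqr_ge0// mulr_ge0// ltW.
move=> x y /andP[x0 x1] /andP[y0 y1].
have [yx|xy] := lerP y x; first exact: main.
have -> : (x - y) ^+ 2 = (y - x) ^+ 2 by ring.
by rewrite distrC; apply: main => //; exact: ltW.
Qed.

(** At x this is the expectation of phi at the number of successes in n
independent trials with probability x; the recursion conditions on the first
trial, so that the variance is obtained without binomial coefficients. *)
Fixpoint bernstein (n : nat) (phi : nat -> R) : {poly R} :=
  if n is n'.+1 then
    'X * bernstein n' (fun k => phi k.+1) + (1 - 'X) * bernstein n' phi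
  else (phi 0%N)%:P.

Lemma bernsteinS n phi x : (bernstein n.+1 phi).[x] =
  x * (bernstein n (fun k => phi k.+1)).[x] + (1 - x) * (bernstein n phi).[x].
Proof. by rewrite /= hornerD !hornerM hornerD hornerN hornerX hornerC. Qed.

Lemma le_bernstein n phi psi x : 0 <= x <= 1 ->
  (forall k, (k <= n)%N -> phi k <= psi k) ->
  (bernstein n phi).[x] <= (bernstein n psi).[x].
Proof.
move=> x01; elim: n phi psi => [|n IH] phi psi H; first by rewrite !hornerC; exact: H.
have /andP[x0 x1] := x01.
rewrite !bernsteinS; apply: lerD; apply: ler_wpM2l => //; rewrite ?subr_ge0//.
  by apply: IH => k kn; apply: H.
by apply: IH => k kn; apply: H; apply: leqW.
Qed.

Lemma bernstein_affine n phi b c x :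
  (bernstein n (fun k => b + c * phi k)).[x] = b + c * (bernstein n phi).[x].
Proof.
elim: n phi => [|n IH] phi; first by rewrite !hornerC.
by rewrite !bernsteinS !IH; ring.
Qed.

(** The centre c is arbitrary because conditioning on the first trial shifts
it. *)
Lemma bernstein_variance n c x :
  (bernstein n (fun k => (k%:R - c) ^+ 2)).[x] =
  n%:R * (x * (1 - x)) + (n%:R * x - c) ^+ 2.
Proof.
elim: n c => [|n IH] c; first by rewrite hornerC; ring.
rewrite bernsteinS IH.
under [X in bernstein n X]eq_fun => k do rewrite -natr1 -addrA -(opprB c).
by rewrite IH -natr1; ring.
Qed.

(** The Bernstein polynomials converge: the quadratic modulus turns the error
into e/2 + K times the variance x (1 - x) / n of the frequency of successes. *)
Lemma powR_poly_approx01 a (e : R) : 0 < a -> 0 < e -> exists p : {poly R},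
  forall x, 0 <= x <= 1 -> `|p.[x] - x `^ a| <= e.
Proof.
move=> a0 e0.
have e20 : 0 < e / 2 by rewrite divr_gt0.
have [K K0 HK] := powR_modulus a0 e20.
pose n := (Num.truncn (K / (e / 2))).+1.
have nK : K / (e / 2) < n%:R by exact: truncnS_gt.
have n0 : 0 < n%:R :> R by rewrite ltr0n.
exists (bernstein n (fun k => (k%:R / n%:R) `^ a)) => x x01.
(* s = 1 and s = -1 give the upper and the lower estimate *)
have bnd (s : R) : `|s| = 1 -> (bernstein n (fun k => 0 + s * (k%:R / n%:R) `^ a)).[x]
    <= s * x `^ a + e.
  move=> s1.
  apply: (@le_trans _ _ (bernstein n (fun k =>
      (s * x `^ a + e / 2) + K / n%:R ^+ 2 * (k%:R - n%:R * x) ^+ 2)).[x]).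
    apply: le_bernstein => // k kn; rewrite add0r.
    have kn01 : 0 <= (k%:R / n%:R : R) <= 1.
      by rewrite divr_ge0//= ler_pdivrMr// mul1r ler_nat.
    have H := HK _ _ kn01 x01.
    have -> : K / n%:R ^+ 2 * (k%:R - n%:R * x) ^+ 2 = K * (k%:R / n%:R - x) ^+ 2.
      by field; rewrite gt_eqF.
    have : s * ((k%:R / n%:R) `^ a - x `^ a) <= `|(k%:R / n%:R) `^ a - x `^ a|.
      by apply: le_trans (ler_norm _) _; rewrite normrM s1 mul1r.
    lra.
  rewrite bernstein_affine bernstein_variance subrr expr0n addr0.
  have -> : K / n%:R ^+ 2 * (n%:R * (x * (1 - x))) = K / n%:R * (x * (1 - x)).
    by field; rewrite gt_eqF.
  have Kn : K / n%:R <= e / 2.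
    rewrite ler_pdivrMr// mulrC -ler_pdivrMr//; exact: ltW.
  have Kn0 : 0 <= K / n%:R by rewrite divr_ge0// ltW.
  have xx1 : x * (1 - x) <= 1 by nra.
  have : K / n%:R * (x * (1 - x)) <= K / n%:R by rewrite ler_piMr.
  lra.
have := bnd 1 (normr1 _); have := bnd (-1) (normrN1 _).
rewrite !bernstein_affine ler_norml => h1 h2; apply/andP; split; lra.
Qed.

Lemma powR_poly_approx a (B e : R) : 0 < a -> 0 < B -> 0 < e -> exists p : {poly R},
  forall x, 0 <= x <= B -> `|p.[x] - x `^ a| <= e.
Proof.
move=> a0 B0 e0; have Ba : 0 < B `^ a by rewrite powR_gt0.
have [p Hp] := powR_poly_approx01 a0 (divr_gt0 e0 Ba).
exists (B `^ a *: (p \Po (B^-1 *: 'X))) => x /andP[x0 xB].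
rewrite hornerZ horner_comp hornerZ hornerX mulrC.
have xB0 : 0 <= x / B by rewrite divr_ge0// ltW.
have {2}-> : x = x / B * B by rewrite mulfVK// gt_eqF.
rewrite powRM ?(ltW B0)// [B^-1 * x]mulrC -mulrBl normrM (gtr0_norm Ba).
rewrite -ler_pdivlMr//; apply: Hp; rewrite xB0/= ler_pdivrMr//; lra.
Qed.

Lemma cmod_powR (z : R[i]) (p : R) : cmod z `^ p = csq z `^ (p / 2).
Proof.
by rewrite cmodE -powR12_sqrt ?csq_ge0// -powRrM mulrC.
Qed.

Lemma csq_bounded (f : R -> R[i]) : trigT f ->
  exists2 B : R, 0 < B & forall t, 0 <= csq (f t) <= B.
Proof.
move=> /trig_bounded[B B0 HB]; exists (B ^+ 2 + 1); first by rewrite ltr_wpDl// sqr_ge0.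
move=> t; rewrite csq_ge0/= -sqr_cmod.
have := HB t; have := cmod_ge0 (f t); nra.
Qed.

(** Uniform approximation by polynomials in |f|^2, which are trigonometric
polynomials. *)
Lemma has_mean_cmod_powR (f : R -> R[i]) (p : R) : trigT f -> 0 < p ->
  exists m, has_mean (fun t => cmod (f t) `^ p) m.
Proof.
move=> hf p0; apply: has_mean_uniform => e e0.
have [B B0 HB] := csq_bounded hf.
have p20 : 0 < p / 2 by rewrite divr_gt0.
have [q Hq] := powR_poly_approx p20 B0 e0.
have [m hm] := trig_has_mean_real (trigT_horner q (trigT_csq hf)).
exists (fun t => q.[csq (f t)]), m; split => // t.
by rewrite cmod_powR distrC; exact: Hq.
Qed.

Lemma has_mean_Hnorm_fin (p : R) A (a : nat -> R[i]) m :
  has_mean (fun t => cmod (dirichlet_poly A a t) `^ p) m ->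
  Hnorm_fin p A a = m `^ p^-1.
Proof. by move=> [_ hm]; congr (_ `^ _); apply: (cvg_lim _ hm). Qed.

Lemma nat_pow_mitE n (t : R) : nat_pow_mit n t = cis (- ln n%:R * t).
Proof. by rewrite mulNr cisN /cis /nat_pow_mit mulrC. Qed.

Lemma trig_dirichlet A (a : nat -> R[i]) : trigT (dirichlet_poly A a).
Proof.
apply: (@trig_sum _ _ _ _ (fun n t => a n * nat_pow_mit n t)) => n _.
rewrite (_ : (fun _ => _) = fun t => a n * cis (- ln n%:R * t)).
  exact: trig_char.
by apply/funext => t; rewrite nat_pow_mitE.
Qed.

Lemma has_mean_dirichlet (p : R) A (a : nat -> R[i]) : 0 < p ->
  exists m, has_mean (fun t => cmod (dirichlet_poly A a t) `^ p) m.
Proof. exact/has_mean_cmod_powR/trig_dirichlet. Qed.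

Lemma lnrN_inj (A : {fset nat}) : 0%N \notin A ->
  {in enum_fset A &, injective (fun n => - ln (n%:R : R))}.
Proof.
move=> A0 x y xA yA /oppr_inj /ln_inj H.
have p z : z \in enum_fset A -> z%:R \is Num.pos.
  move=> zA; rewrite posrE ltr0n lt0n; apply: contraNneq A0 => <-; exact: zA.
by apply/eqP; rewrite -(eqr_nat R); apply/eqP; apply: H; exact: p.
Qed.

Lemma mean_csq_dirichlet A (a : nat -> R[i]) : 0%N \notin A -> unimodular_on A a ->
  has_mean (fun t => csq (dirichlet_poly A a t)) #|` A|%:R.
Proof.
move=> A0 a1.
have := @mean_csq_unimodular R _ (enum_fset A) (fun n => - ln n%:R) a
  (fset_uniq A) (lnrN_inj A0) a1.
congr has_mean; apply/funext => t; congr csq.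
by apply: eq_bigr => n _; rewrite nat_pow_mitE.
Qed.

End Weierstrass.

(** * Damping factors with nonpositive spectrum *)

Section Multiplier.
Variable R : realType.
Local Notation Re := (@complex.Re R).
Implicit Types (f g h : R -> R[i]).

Lemma trig_split f : trigT f -> exists c n p,
  [/\ trig (fun l : R => l < 0) n, trig (fun l : R => 0 < l) p &
      f = fun t => c + n t + p t].
Proof.
elim=> [|c l _|f1 f2 _ [c1 [n1 [p1 [hn1 hp1 ->]]]] _ [c2 [n2 [p2 [hn2 hp2 ->]]]]].
- exists 0, (fun=> 0), (fun=> 0); split; try exact: trig0.
  by apply/funext => t; rewrite !addr0.
- have [l0|l0|->] := ltrgt0P l.
  + exists 0, (fun=> 0), (fun t => c * cis (l * t)); split; first exact: trig0.
      exact: trig_char.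
    by apply/funext => t; rewrite !add0r.
  + exists 0, (fun t => c * cis (l * t)), (fun=> 0); split; last 1 first.
    * by apply/funext => t; rewrite addr0 add0r.
    * exact: (@trig_char _ (fun l : R => l < 0)).
    * exact: trig0.
  + exists c, (fun=> 0), (fun=> 0); split; try exact: trig0.
    by apply/funext => t; rewrite !addr0 mul0r cis0 mulr1.
- exists (c1 + c2), (fun t => n1 t + n2 t), (fun t => p1 t + p2 t).
  split; [exact: trigD|exact: trigD|].
  by apply/funext => t; ring.
Qed.

Lemma csq_Re_sqr (z : R[i]) : csq z = 2 * Re z ^+ 2 - Re (z ^+ 2).
Proof. by case: z => a b; rewrite /csq expr2 /=; ring. Qed.

(** Conjugating the part of g with positive frequencies makes the spectrum
nonpositive and does not change the real part.  The square of the result h has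
mean r^2, where r is the constant term; so r^2 = M(Re h^2) = 2 M(g^2) - M(|h|^2). *)
Lemma analytic_completion (g : R -> R) (m : R) :
  trigT (fun t => (g t)%:C) -> has_mean (fun t => g t ^+ 2) m ->
  exists2 h, trig (fun l => l <= 0) h & [/\ forall t, Re (h t) = g t &
    exists2 M, has_mean (fun t => csq (h t)) M & M <= 2 * m].
Proof.
move=> /trig_split[c [n [p [hn hp gE]]]] hm.
pose q t := n t + (p t)^*; pose r := Re c.
have hq : trig (fun l => l < 0) q.
  apply: trigD => //; apply: trig_sub (trig_conj hp) => l; by rewrite oppr_gt0.
have hRe t : Re (r%:C + q t) = g t.
  have -> : g t = Re (c + n t + p t) by rewrite -(congr1 (@^~ t) gE).
  by rewrite /q !ReD /r /= -addrA; case: (p t).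
exists (fun t => r%:C + q t).
  apply: trigD; first exact: trig_cst.
  by apply: trig_sub hq => l; exact: ltW.
split=> //; exists (2 * m - r ^+ 2); last by rewrite gerBl sqr_ge0.
under eq_fun do rewrite csq_Re_sqr hRe.
apply: has_meanB; first exact: has_meanZ.
have -> : (fun t => Re ((r%:C + q t) ^+ 2)) =
          (fun t => r ^+ 2 + Re ((2 * r)%:C * q t + q t * q t)).
  apply/funext => t; case: (q t) => a b; rewrite expr2 /=; ring.
rewrite -[X in has_mean _ X]addr0; apply: has_meanD; first exact: has_mean_cst.
apply: (@trig_mean0 _ (fun l => l < 0)); last by rewrite ltxx.
apply: trigD; first exact: trigZ.
by apply: (trigM _ hq hq) => x y x0 y0; lra.
Qed.

Lemma bernoulli_expn (y : R) n : 0 <= y -> 1 + n%:R * y <= (1 + y) ^+ n.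
Proof.
move=> y0; elim: n => [|n IH]; first by rewrite mul0r addr0 expr0.
rewrite exprS -natr1.
have : (1 + y) * (1 + n%:R * y) <= (1 + y) * (1 + y) ^+ n.
  by rewrite ler_wpM2l// addr_ge0.
apply: le_trans; rewrite -subr_ge0.
have -> : (1 + y) * (1 + n%:R * y) - (1 + (n%:R + 1) * y) = n%:R * y ^+ 2 by ring.
by rewrite mulr_ge0// sqr_ge0.
Qed.

Lemma pow_onem_le (x : R) n : (0 < n)%N -> 0 <= x -> 0 <= 1 - x / n%:R ->
  (1 - x / n%:R) ^+ n * (1 + x) <= 1.
Proof.
move=> n0 x0 y1; have nR : 0 < n%:R :> R by rewrite ltr0n.
have y0 : 0 <= x / n%:R by rewrite divr_ge0// ltW.
apply: (@le_trans _ _ ((1 - x / n%:R) ^+ n * (1 + x / n%:R) ^+ n)).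
  rewrite ler_wpM2l ?exprn_ge0//; apply: le_trans (bernoulli_expn n y0).
  by rewrite mulrC mulfVK// gt_eqF.
rewrite -exprMn; apply: exprn_ile1; first by rewrite mulr_ge0// addr_ge0.
by rewrite -subr_sqr expr1n gerBl sqr_ge0.
Qed.

Lemma cmod_onemX_le (w : R[i]) n : cmod w <= 1 -> cmod (1 - w ^+ n) <= n%:R * cmod (1 - w).
Proof.
move=> w1; elim: n => [|n IH].
  by rewrite expr0 subrr normc0 mul0r.
have -> : 1 - w ^+ n.+1 = (1 - w) + w * (1 - w ^+ n) by rewrite exprS; ring.
apply: le_trans (le_normcD _ _) _.
rewrite normcM -natr1 mulrDl mul1r addrC lerD2r.
by apply: le_trans IH; rewrite ler_piMl// cmod_ge0.
Qed.

(** The classical choice is E = exp (- e h), where h has nonpositive spectrum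
and real part |f|.  Here |f| is replaced by a trigonometric polynomial g
slightly above it, and the exponential by (1 - e h / n)^n with n = 2 r large,
so that E is itself a trigonometric polynomial.  Since
|1 - e h / n|^2 = 1 - 2 e g / n + e^2 |h|^2 / n^2 and g >= |f| + d, a large n
makes this at most 1 - e |f| / r. *)
Lemma multiplier f (s e : R) : trigT f -> has_mean (fun t => csq (f t)) s ->
  0 < s -> 0 < e ->
  exists Eh : (R -> R[i]) * (R -> R[i]),
    [/\ trig (fun l => l <= 0) Eh.1,
        forall t, cmod (Eh.1 t) * (1 + e * cmod (f t)) <= 1,
        forall t, cmod (1 - Eh.1 t) <= e * cmod (Eh.2 t)
      & exists2 M, has_mean (fun t => csq (Eh.2 t)) M & M <= 8 * s].
Proof.
move=> hf hs s0 e0.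
(* (|f| + 3 d)^2 <= 2 |f|^2 + 18 d^2, and 18 d^2 <= 2 s *)
pose d := Num.min 1 (s / 9).
have d0 : 0 < d by rewrite lt_min ltr01 divr_gt0.
have d1 : d <= 1 by rewrite ge_min lexx.
have ds : d <= s / 9 by rewrite ge_min lexx orbT.
have [B B0 HB] := csq_bounded hf.
have a0 : 0 < 2^-1 :> R by rewrite invr_gt0.
have [p Hp] := powR_poly_approx a0 B0 d0.
pose g t := p.[csq (f t)] + 2 * d.
have gb t : cmod (f t) + d <= g t <= cmod (f t) + 3 * d.
  have := Hp _ (HB t); rewrite powR12_sqrt ?csq_ge0// -cmodE ler_norml /g.
  by move=> /andP[? ?]; apply/andP; split; lra.
have hg : trigT (fun t => (g t)%:C).
  rewrite (_ : (fun _ => _) = fun t => p.[csq (f t)]%:C + (2 * d)%:C).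
    apply: trigD; [exact/trigT_horner/trigT_csq|exact: trig_cst].
  by apply/funext => t; rewrite rmorphD.
have [m hm] : exists m, has_mean (fun t => g t ^+ 2) m.
  apply: trig_has_mean_real.
  rewrite (_ : (fun _ => _) = fun t => (g t)%:C * (g t)%:C); first exact: (trigM _ hg hg).
  by apply/funext => t; rewrite expr2 rmorphM.
have mle : m <= 4 * s.
  have := le_has_mean hm (has_meanD (has_meanZ 2 hs) (has_mean_cst (2 * s))).
  have -> : 4 * s = 2 * s + 2 * s by ring.
  apply=> t; rewrite -sqr_cmod.
  have /andP[g1 g2] := gb t; have c0 := cmod_ge0 (f t).
  apply: (@le_trans _ _ ((cmod (f t) + 3 * d) ^+ 2)).
    by rewrite lerXn2r// nnegrE; lra.
  apply: (@le_trans _ _ (2 * cmod (f t) ^+ 2 + 18 * d ^+ 2)).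
    by rewrite -subr_ge0 (_ : _ - _ = (cmod (f t) - 3 * d) ^+ 2) ?sqr_ge0//; ring.
  have : d ^+ 2 <= d by rewrite expr2 ler_piMr// ltW.
  lra.
have [h hh [hRe [M hM MM]]] := analytic_completion hg hm.
have [K K0 HK] := csq_bounded (trig_trigT hh).
(* large enough for e^2 |h|^2 / (2 r)^2 <= e d / r *)
pose r := (Num.truncn (e * K / (4 * d))).+1.
have r0 : 0 < r%:R :> R by rewrite ltr0n.
have rK : e * K <= 4 * d * r%:R.
  have d4 : 0 < 4 * d by rewrite mulr_gt0.
  rewrite [leRHS]mulrC -ler_pdivrMr//.
  apply: (@le_trans _ _ (Num.truncn (e * K / (4 * d))).+1%:R).
    exact/ltW/truncnS_gt.
  by rewrite ler_nat ltnS.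
pose w t := 1 - (e / (2 * r)%:R)%:C * h t.
have wE t : csq (w t) <= 1 - e * cmod (f t) / r%:R.
  have -> : csq (w t) = 1 - e * g t / r%:R + e ^+ 2 * csq (h t) / (4 * r%:R ^+ 2).
    rewrite -hRe /w; case: (h t) => x y; rewrite /csq /= natrM; field.
    by rewrite gt_eqF.
  have /andP[g1 _] := gb t; have /andP[_ hK] := HK t.
  have h1 : e ^+ 2 * csq (h t) / (4 * r%:R ^+ 2) <= e * d / r%:R.
    rewrite ler_pdivrMr ?mulr_gt0 ?exprn_gt0//.
    have -> : e * d / r%:R * (4 * r%:R ^+ 2) = e * (4 * d * r%:R) by field; rewrite gt_eqF.
    rewrite expr2 -mulrA ler_wpM2l ?(ltW e0)//; apply: le_trans rK.
    by rewrite ler_wpM2l// ltW.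
  have h2 : e * (cmod (f t) + d) / r%:R <= e * g t / r%:R.
    by rewrite ler_wpM2r ?invr_ge0 ?(ltW r0)// ler_wpM2l// ltW.
  have h3 : e * (cmod (f t) + d) / r%:R = e * cmod (f t) / r%:R + e * d / r%:R by ring.
  by move: h2; rewrite h3; lra.
have fr t : 0 <= e * cmod (f t) / r%:R.
  by rewrite divr_ge0 ?mulr_ge0 ?cmod_ge0// ltW.
have w1 t : cmod (w t) <= 1.
  have : csq (w t) <= 1 by have := wE t; have := fr t; lra.
  by rewrite -sqr_cmod expr_le1// cmod_ge0.
exists (fun t => w t ^+ (2 * r), h); split => /=.
- apply: trigX => //; first by move=> x y x0 y0; lra.
  apply: trigD; first exact: trig_cst.
  by apply: trigN; exact: trigZ.
- move=> t; rewrite cmodX exprM sqr_cmod.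
  have ef : 0 <= e * cmod (f t) by rewrite mulr_ge0 ?cmod_ge0// ltW.
  have y1 : 0 <= 1 - e * cmod (f t) / r%:R by apply: le_trans (wE t); exact: csq_ge0.
  apply: le_trans (@pow_onem_le _ r _ ef y1) => //.
  by rewrite ler_wpM2r ?addr_ge0// lerXn2r// nnegrE ?csq_ge0.
- move=> t; apply: le_trans (cmod_onemX_le _ (w1 t)) _.
  rewrite /w opprB addrC subrK normcM cmod_real.
  rewrite gtr0_norm ?divr_gt0 ?ltr0n//.
  by rewrite mulrA mulrCA mulfV ?mulr1// pnatr_eq0.
- by exists M => //; lra.
Qed.

End Multiplier.

(** * Littlewood's inequality *)

Section Littlewood.
Variable R : realType.
Local Notation Re := (@complex.Re R).
Variables (l : nat -> R) (a : nat -> R[i]).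
Hypothesis lmono : forall i j, (i < j)%N -> l i < l j.
Hypothesis a1 : forall i, cmod (a i) = 1.

(** The blocks [blk j, blk (j+1)) have 4^j elements, so that about log N of
them are needed to exhaust N frequencies, and all the frequencies up to the end
of a block are at most 4/3 times as many as those in the block. *)
Definition blk (j : nat) : nat := \sum_(0 <= k < j) 4 ^ k.

Lemma blkS j : blk j.+1 = (blk j + 4 ^ j)%N.
Proof. by rewrite /blk big_nat_recr. Qed.

Lemma blkE j : (3 * blk j).+1 = (4 ^ j)%N.
Proof.
elim: j => [|j IH]; first by rewrite /blk big_nil.
by rewrite blkS expnS; lia.
Qed.

Lemma blk_mono i j : (i <= j)%N -> (blk i <= blk j)%N.
Proof. by move=> ij; have := blkE i; have := blkE j; have := @leq_pexp2l 4 i j isT ij; lia. Qed.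

Definition psum (i j : nat) (t : R) : R[i] := \sum_(i <= k < j) a k * cis (l k * t).

Lemma psum_cat i j k t : (i <= j)%N -> (j <= k)%N ->
  psum i k t = psum i j t + psum j k t.
Proof. by move=> ij jk; rewrite /psum (big_cat_nat ij jk). Qed.

Lemma cmod_psum_le i j t : cmod (psum i j t) <= (j - i)%:R.
Proof.
apply: le_trans (cmod_sum_le _ _ _) _.
under eq_bigr do rewrite normcM a1 cmod_cis mulr1.
by rewrite sumr_const_nat.
Qed.

Lemma trig_psum i j : trig (fun x => exists2 k, (i <= k < j)%N & x = l k) (psum i j).
Proof.
apply: (@trig_sum _ _ _ _ (fun k t => a k * cis (l k * t))) => k.
by rewrite mem_index_iota => ijk; apply: trig_char; exists k.
Qed.

Lemma mean_psum i j : has_mean (fun t => csq (psum i j t)) (j - i)%:R.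
Proof.
rewrite -[(j - i)%N](size_iota i); apply: mean_csq_unimodular => //.
- exact: iota_uniq.
- move=> x y _ _ e; case: (ltngtP x y) => // xy.
    by have := lmono xy; rewrite e ltxx.
  by have := lmono xy; rewrite e ltxx.
Qed.

(** Serves twice: for the sum above a block against the damped block, and for a
block against the sum below it. *)
Lemma mean_psum_orth (P : R -> Prop) i j g : trig P g ->
  (forall k x, (i <= k < j)%N -> P x -> x < l k) ->
  has_mean (fun t => Re (psum i j t * (g t)^*)) 0.
Proof.
move=> hg Hlt.
apply: (@trig_mean0 _ (fun x => 0 < x)); last by rewrite ltxx.
apply: (trigM _ (trig_psum i j) (trig_conj hg)) => x y [k ijk ->] Py.
by have := Hlt _ _ ijk Py; lra.
Qed.

Lemma ReM_conjC (z w : R[i]) : Re (z * w^*) = Re (w * z^*).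
Proof. by case: z w => [? ?] [? ?] /=; ring. Qed.

(** Normalised to have modulus at most 1; its mean square is 4^-j. *)
Definition blkf (j : nat) (t : R) : R[i] := ((4 ^+ j)^-1)%:C * psum (blk j) (blk j.+1) t.

Lemma blkS_sub j : (blk j.+1 - blk j)%N = (4 ^ j)%N.
Proof. by rewrite blkS addKn. Qed.

Let p4 j : 0 < 4 ^+ j :> R. Proof. by rewrite exprn_gt0. Qed.

Lemma blkf_le1 j t : cmod (blkf j t) <= 1.
Proof.
rewrite /blkf normcM cmod_real gtr0_norm ?invr_gt0//.
rewrite ler_pdivrMl// mulr1; apply: le_trans (cmod_psum_le _ _ _) _.
by rewrite blkS_sub natrX.
Qed.

Lemma csqZ (x : R) (z : R[i]) : csq (x%:C * z) = x ^+ 2 * csq z.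
Proof. by case: z => y z; rewrite /csq /=; ring. Qed.

Lemma mean_blkf j : has_mean (fun t => csq (blkf j t)) ((4 ^+ j)^-1).
Proof.
under eq_fun do rewrite csqZ.
have e : (4 ^+ j)^-1 ^+ 2 * (4 ^ j)%:R = (4 ^+ j)^-1 :> R.
  by rewrite natrX expr2 -mulrA mulVf ?mulr1// gt_eqF.
by rewrite -[X in has_mean _ X]e; apply: has_meanZ; rewrite -blkS_sub; exact: mean_psum.
Qed.

Lemma trig_blkf j : trig (fun x => x <= l (blk j.+1).-1) (blkf j).
Proof.
apply: trigZ; apply: trig_sub (trig_psum _ _) => x [k /andP[k1 k2] ->].
have [->//|kn] := eqVneq k (blk j.+1).-1.
by apply/ltW/lmono; lia.
Qed.

Lemma cmod_onem_prod_le (s : seq nat) (E : nat -> R[i]) :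
  (forall k, cmod (E k) <= 1) ->
  cmod (\prod_(k <- s) E k) <= 1 /\
  cmod (1 - \prod_(k <- s) E k) <= \sum_(k <- s) cmod (1 - E k).
Proof.
move=> E1; elim: s => [|k s [IH1 IH2]].
  by rewrite !big_nil subrr normc0 normc1.
rewrite !big_cons; split.
  by rewrite normcM mulr_ile1// cmod_ge0.
have -> : 1 - E k * \prod_(i <- s) E i = (1 - E k) + E k * (1 - \prod_(i <- s) E i).
  by ring.
apply: le_trans (le_normcD _ _) _; rewrite lerD2l normcM.
by apply: le_trans IH2; rewrite ler_piMl// cmod_ge0.
Qed.

Lemma sum_half_le j m : (j < m)%N ->
  \sum_(j.+1 <= k < m) (2 ^+ k)^-1 + 2 * (2 ^+ m)^-1 <= (2 ^+ j)^-1 :> R.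
Proof.
elim: m => // m IH; rewrite ltnS leq_eqVlt => /predU1P[->|jm].
  by rewrite big_geq// add0r exprS invfM mulrA mulfV ?mul1r// pnatr_eq0.
rewrite big_nat_recr//=; apply: le_trans (IH jm).
by rewrite -addrA lerD2l exprS invfM mulrA mulfV ?pnatr_eq0//; lra.
Qed.

(** The contribution of one block to the pairing of f = [psum 0 N] with the
test polynomial is 1 up to the error caused by damping.  The part of f above
block j is orthogonal to the damped block, whose spectrum does not exceed that
of the block.  The part S of f up to block j has modulus at most 4^(j+1)/3 and
pairs to exactly 1 with the undamped block, while
|f_j| |1 - product of the E_k| <= sum of |f_j| |h_k| / 8 is controlled by the
inequality of the means: |f_j| has mean square 4^-j and |h_k| at most 8 * 4^-k,
and the terms with k > j add up geometrically. *)
Lemma littlewood_step j m (E h : nat -> R -> R[i]) N X :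
  (j < m)%N -> (blk m <= N)%N ->
  (forall k, trig (fun x => x <= 0) (E k)) ->
  (forall k t, cmod (E k t) <= 1) ->
  (forall k t, cmod (1 - E k t) <= 8^-1 * cmod (h k t)) ->
  (forall k, exists2 M, has_mean (fun t => csq (h k t)) M & M <= 8 * (4 ^+ k)^-1) ->
  has_mean (fun t => Re (psum 0 N t * (blkf j t * \prod_(j.+1 <= k < m) E k t)^*)) X ->
  2^-1 <= X.
Proof.
move=> jm mN hE E1 Eh hM hX.
have /choice[M HM] : forall k, exists M,
    has_mean (fun t => csq (h k t)) M /\ M <= 8 * (4 ^+ k)^-1.
  by move=> k; have [M ? ?] := hM k; exists M.
pose Q t := \prod_(j.+1 <= k < m) E k t.
have hQ : trig (fun x => x <= 0) Q.
  apply: trig_prod => //; by move=> x y; lra.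
have hG : trig (fun x => x <= l (blk j.+1).-1) (fun t => blkf j t * Q t).
  by apply: (trigM _ (trig_blkf j) hQ) => x y; lra.
have jN : (blk j.+1 <= N)%N by apply: leq_trans mN; exact: blk_mono.
have bj : (blk j <= blk j.+1)%N by apply: blk_mono.
have bj0 : (0 < blk j.+1)%N by have := blkE j.+1; have := expn_gt0 4 j; rewrite expnS; lia.
pose T t := Re (psum (blk j.+1) N t * (blkf j t * Q t)^*).
have hT : has_mean T 0.
  apply: (mean_psum_orth hG) => k x /andP[k1 _] xl.
  by apply: le_lt_trans xl _; apply: lmono; lia.
pose V t := Re (psum 0 (blk j.+1) t * (blkf j t)^*).
have p4n := lt0r_neq0 (p4 j).
have hV : has_mean V 1.
  have -> : V = fun t => 4 ^+ j * csq (blkf j t) +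
      (4 ^+ j)^-1 * Re (psum (blk j) (blk j.+1) t * (psum 0 (blk j) t)^*).
    apply/funext => t; rewrite /V (@psum_cat 0 (blk j))// mulrDl ReD addrC.
    congr (_ + _).
      rewrite csqE /blkf -ReZ mulrA; congr (Re (_ * _)).
      by rewrite mulrA -rmorphM mulfV// mul1r.
    rewrite ReM_conjC -ReZ mulrA; congr (Re _).
  rewrite -[X in has_mean _ X]addr0; apply: has_meanD.
    by rewrite -[X in has_mean _ X](mulfV p4n); apply: has_meanZ; exact: mean_blkf.
  rewrite -[X in has_mean _ X](mulr0 (4 ^+ j)^-1); apply: has_meanZ.
  apply: (mean_psum_orth (trig_psum 0 (blk j))) => k x /andP[k1 _] [i /andP[_ ik] ->].
  by apply: lmono; lia.
(* q k is the ratio of the mean square norms 2^-k and 2^-j of blocks k and j;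
   it is the weight that balances |f_j| |h_k| <= (3 q |f_j|^2 + |h_k|^2 / (3 q)) / 2 *)
pose q (k : nat) : R := 2 ^+ j / 2 ^+ k.
have q0 k : 0 < q k by rewrite divr_gt0// exprn_gt0.
have q4 k : (4 ^+ k)^-1 = (4 ^+ j)^-1 * q k ^+ 2.
  have -> : (4 : R) = 2 ^+ 2 by rewrite -natrX.
  by rewrite /q -!exprM ![(2 * _)%N]mulnC !exprM; field; rewrite !expf_neq0// pnatr_eq0.
pose U t := 4 ^+ j / 6 * \sum_(j.+1 <= k < m)
  ((3 * q k / 2) * csq (blkf j t) + (6 * q k)^-1 * csq (h k t)).
pose Um := 4 ^+ j / 6 * \sum_(j.+1 <= k < m)
  ((3 * q k / 2) * (4 ^+ j)^-1 + (6 * q k)^-1 * M k).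
have hU : has_mean U Um.
  apply: has_meanZ; apply: has_mean_sum => k; apply: has_meanD; apply: has_meanZ.
    exact: mean_blkf.
  by have [] := HM k.
have UmB : Um <= 2^-1.
  apply: (@le_trans _ _ (4 ^+ j / 6 * (\sum_(j.+1 <= k < m) (4 ^+ j)^-1 * 3 * q k))).
    rewrite ler_wpM2l ?divr_ge0 ?(ltW (p4 j))//; apply: ler_sum => k _.
    have [_ Mk] := HM k; rewrite q4 in Mk.
    have : (6 * q k)^-1 * M k <= (6 * q k)^-1 * (8 * ((4 ^+ j)^-1 * q k ^+ 2)).
      by rewrite ler_wpM2l// invr_ge0 mulr_ge0// ltW.
    have -> : (6 * q k)^-1 * (8 * ((4 ^+ j)^-1 * q k ^+ 2)) = 8 / 6 * ((4 ^+ j)^-1 * q k).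
      by field; rewrite p4n gt_eqF.
    have : 0 <= (4 ^+ j)^-1 * q k by rewrite mulr_ge0 ?ltW// invr_ge0 ltW.
    lra.
  rewrite -mulr_sumr -mulr_sumr.
  have -> : 4 ^+ j / 6 * ((4 ^+ j)^-1 * 3 * (2 ^+ j * \sum_(j.+1 <= k < m) (2 ^+ k)^-1)) =
     2^-1 * (2 ^+ j * \sum_(j.+1 <= k < m) (2 ^+ k)^-1) :> R by field.
  rewrite ler_piMr// mulrC -ler_pdivlMr ?exprn_gt0// div1r.
  apply: le_trans (sum_half_le jm); rewrite lerDl mulr_ge0// invr_ge0 exprn_ge0//.
have key t : V t - U t + T t <= Re (psum 0 N t * (blkf j t * Q t)^*).
  rewrite (@psum_cat 0 (blk j.+1) N)// mulrDl ReD /T lerD2r.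
  have -> : Re (psum 0 (blk j.+1) t * (blkf j t * Q t)^*) =
            V t - Re (psum 0 (blk j.+1) t * (blkf j t * (1 - Q t))^*).
    rewrite /V; case: (psum _ _ _) (blkf _ _) (Q t) => [x1 y1] [x2 y2] [x3 y3] /=.
    ring.
  rewrite lerD2l lerN2; apply: le_trans (ReM_conj_le _ _) _.
  rewrite normcM.
  have [_ Q1] := @cmod_onem_prod_le (index_iota j.+1 m) (fun k => E k t) (fun k => E1 k t).
  have {}Q1 : cmod (1 - Q t) <= \sum_(j.+1 <= k < m) 8^-1 * cmod (h k t).
    by apply: le_trans Q1 _; apply: ler_sum => k _; exact: Eh.
  have f0 := cmod_ge0 (blkf j t).
  apply: (@le_trans _ _ (4 * 4 ^+ j / 3 *
      (cmod (blkf j t) * \sum_(j.+1 <= k < m) 8^-1 * cmod (h k t)))).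
    apply: ler_pM; rewrite ?mulr_ge0 ?cmod_ge0//.
      apply: le_trans (cmod_psum_le _ _ _) _; rewrite subn0 ler_pdivlMr//.
      have : ((3 * blk j.+1)%:R <= (4 ^ j.+1)%:R :> R) by rewrite ler_nat -blkE.
      by rewrite natrM natrX exprS; lra.
    by rewrite ler_wpM2l.
  have -> : 4 * 4 ^+ j / 3 *
      (cmod (blkf j t) * \sum_(j.+1 <= k < m) 8^-1 * cmod (h k t)) =
    4 ^+ j / 6 * \sum_(j.+1 <= k < m) (cmod (blkf j t) * cmod (h k t)).
    by rewrite -!mulr_sumr; field.
  rewrite /U ler_wpM2l ?divr_ge0 ?(ltW (p4 j))//; apply: ler_sum => k _.
  rewrite -!sqr_cmod -subr_ge0; set x := cmod _; set y := cmod _.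
  have -> : 3 * q k / 2 * x ^+ 2 + (6 * q k)^-1 * y ^+ 2 - x * y =
     (3 * q k * x - y) ^+ 2 / (6 * q k) by field; rewrite gt_eqF.
  by rewrite divr_ge0 ?sqr_ge0// mulr_ge0// ltW.
have := le_has_mean (has_meanD (has_meanB hV hU) hT) hX key.
lra.
Qed.

(** Each new block is added after all the earlier ones have been damped where
it is large, which keeps the sum bounded. *)
Fixpoint testpoly (E : nat -> R -> R[i]) (m : nat) (t : R) : R[i] :=
  if m is m'.+1 then testpoly E m' t * E m' t + blkf m' t else 0.

Lemma testpolyE E m t :
  testpoly E m t = \sum_(0 <= j < m) blkf j t * \prod_(j.+1 <= k < m) E k t.
Proof.
elim: m => [|m IH]; first by rewrite big_nil.
rewrite /= IH big_nat_recr//= [X in _ = _ + _ * X]big_geq// mulr1.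
congr (_ + _).
rewrite mulr_suml; apply: eq_big_nat => j /andP[_ jm].
by rewrite big_nat_recr//= mulrA.
Qed.

(** If |F| <= 9 and x = |f_m| <= 1, then 9 / (1 + x/8) + x <= 9. *)
Lemma testpoly_le E m t : (forall k t, cmod (E k t) * (1 + 8^-1 * cmod (blkf k t)) <= 1) ->
  cmod (testpoly E m t) <= 9.
Proof.
move=> HE; elim: m => [|m IH]; first by rewrite (_ : testpoly E 0 t = 0)// normc0.
rewrite (_ : testpoly E m.+1 t = testpoly E m t * E m t + blkf m t)//.
apply: le_trans (le_normcD _ _) _; rewrite normcM.
have := HE m t; have := blkf_le1 m t; have := cmod_ge0 (blkf m t).
have := cmod_ge0 (E m t); move: IH; have := cmod_ge0 (testpoly E m t).
set F := cmod _; set e := cmod _; set x := cmod _ => F0 F9 e0 x0 x1 ex.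
have : F * e <= 9 * e by rewrite ler_wpM2r.
nra.
Qed.

(** The pairing of f with the test polynomial is at least m/2 and at most
9 M(|f|). *)
Theorem littlewood_lower_bound m N X : (blk m <= N)%N ->
  has_mean (fun t => cmod (psum 0 N t)) X -> m%:R <= 18 * X.
Proof.
move=> mN hX.
have e8 : 0 < 8^-1 :> R by rewrite invr_gt0.
have /choice[Eh HEh] : forall k, exists Eh : (R -> R[i]) * (R -> R[i]),
    [/\ trig (fun l => l <= 0) Eh.1,
        forall t, cmod (Eh.1 t) * (1 + 8^-1 * cmod (blkf k t)) <= 1,
        forall t, cmod (1 - Eh.1 t) <= 8^-1 * cmod (Eh.2 t)
      & exists2 M, has_mean (fun t => csq (Eh.2 t)) M & M <= 8 * (4 ^+ k)^-1].
  move=> k; have s0 : 0 < (4 ^+ k)^-1 :> R by rewrite invr_gt0.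
  exact: (multiplier (trig_trigT (trig_blkf k)) (mean_blkf k) s0 e8).
pose E k := (Eh k).1; pose h k := (Eh k).2.
have E1 k t : cmod (E k t) <= 1.
  have [_ + _ _] := HEh k => /(_ t); apply: le_trans.
  by rewrite ler_peMr ?cmod_ge0// lerDl mulr_ge0 ?cmod_ge0// ltW.
have hE k : trig (fun x => x <= 0) (E k) by have [] := HEh k.
have hpsum : trigT (psum 0 N) by exact: trig_trigT (trig_psum 0 N).
have /choice[Y HY] : forall j, exists Y,
    has_mean (fun t => Re (psum 0 N t * (blkf j t * \prod_(j.+1 <= k < m) E k t)^*)) Y.
  move=> j; have hQ : trigT (fun t => \prod_(j.+1 <= k < m) E k t).
    by apply: trig_prod => // k _; exact: trig_trigT (hE k).
  have hG : trigT (fun t => blkf j t * \prod_(j.+1 <= k < m) E k t).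
    exact: (trigM _ (trig_trigT (trig_blkf j)) hQ).
  by apply: trig_has_mean; exact: (trigM _ hpsum (trig_conj hG)).
have hY : has_mean (fun t => Re (psum 0 N t * (testpoly E m t)^*)) (\sum_(0 <= j < m) Y j).
  have -> : (fun t => Re (psum 0 N t * (testpoly E m t)^*)) = fun t =>
     \sum_(0 <= j < m) Re (psum 0 N t * (blkf j t * \prod_(j.+1 <= k < m) E k t)^*).
    by apply/funext => t; rewrite testpolyE rmorph_sum mulr_sumr Re_sum.
  exact: has_mean_sum.
have Yge : m%:R / 2 <= \sum_(0 <= j < m) Y j.
  have -> : m%:R / 2 = \sum_(0 <= j < m) 2^-1 :> R.
    by rewrite sumr_const_nat subn0 mulr_natl.
  apply: ler_sum_nat => j /andP[_ jm].
  apply: (@littlewood_step _ _ E h _ _ jm mN hE E1 _ _ (HY j)) => k.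
    by move=> t; have [_ _ H _] := HEh k; exact: H.
  by have [] := HEh k.
have Yle : \sum_(0 <= j < m) Y j <= 9 * X.
  apply: (le_has_mean hY (has_meanZ 9 hX)) => t.
  apply: le_trans (ReM_conj_le _ _) _; rewrite mulrC ler_wpM2r ?cmod_ge0//.
  by apply: testpoly_le => k {}t; have [_ + _ _] := HEh k; exact.
lra.
Qed.

End Littlewood.

(** * Sets of powers of 2 and the Dirichlet kernel *)

Section Periodic.
Variable R : realType.

Definition pow2set (e : nat -> nat) (N : nat) : {fset nat} :=
  seq_fset tt [seq (2 ^ e k)%N | k <- iota 0 N].

Lemma pow2set0 e N : 0%N \notin pow2set e N.
Proof. by rewrite seq_fsetE; apply/mapP => -[k _ /esym/eqP]; rewrite expn_eq0. Qed.

Lemma pow2set_perm (e : nat -> nat) N : injective e ->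
  perm_eq (pow2set e N) [seq (2 ^ e k)%N | k <- iota 0 N].
Proof.
move=> einj; apply: perm_trans (seq_fset_perm _ _) _.
rewrite undup_id// map_inj_uniq ?iota_uniq// => x y /eqP.
by rewrite eqn_exp2l// => /eqP/einj.
Qed.

Lemma card_pow2set (e : nat -> nat) N : injective e -> #|` pow2set e N| = N.
Proof. by move=> /(@pow2set_perm _ N)/perm_size; rewrite size_map size_iota. Qed.

Definition z2 (t : R) : R[i] := nat_pow_mit 2 t.

Lemma z2E t : z2 t = cis (- ln 2 * t).
Proof. exact: nat_pow_mitE. Qed.

Lemma cmod_z2 t : cmod (z2 t) = 1.
Proof. by rewrite z2E cmod_cis. Qed.

Lemma nat_pow_mit_exp2 k t : nat_pow_mit (2 ^ k) t = z2 t ^+ k :> R[i].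
Proof.
rewrite nat_pow_mitE z2E cisX natrX lnXn//; congr cis.
by rewrite -mulr_natl; ring.
Qed.

Lemma dirichlet_pow2set e N (a : nat -> R[i]) t : injective e ->
  dirichlet_poly (pow2set e N) a t = \sum_(0 <= k < N) a (2 ^ e k)%N * z2 t ^+ e k.
Proof.
move=> einj; rewrite /dirichlet_poly.
rewrite (perm_big _ (pow2set_perm N einj)) big_map /index_iota subn0.
by apply: eq_bigr => k _; rewrite nat_pow_mit_exp2.
Qed.

Lemma unimodular1 A : unimodular_on A (fun=> 1 : R[i]).
Proof. by move=> n _; rewrite normc1. Qed.

Definition dker (n : nat) (t : R) : R[i] := \sum_(0 <= k < n) z2 t ^+ k.

Lemma dkerE n t : dker n t = dirichlet_poly (pow2set id n) (fun=> 1) t.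
Proof.
by rewrite dirichlet_pow2set//; apply: eq_bigr => k _; rewrite mul1r.
Qed.

Lemma mean_csq_dker n : has_mean (fun t => csq (dker n t)) n%:R.
Proof.
under eq_fun do rewrite dkerE.
rewrite -{2}(@card_pow2set id n)//; apply: mean_csq_dirichlet.
  exact: pow2set0.
exact: unimodular1.
Qed.

Lemma cmod_dker_le n t : cmod (dker n t) <= n%:R.
Proof.
apply: le_trans (cmod_sum_le _ _ _) _.
under eq_bigr do rewrite cmodX cmod_z2 expr1n.
by rewrite sumr_const_nat subn0.
Qed.

Lemma dker_telescope n t : (1 - z2 t) * dker n t = 1 - z2 t ^+ n.
Proof.
elim: n => [|n IH]; first by rewrite /dker big_geq// mulr0 expr0 subrr.
by rewrite /dker big_nat_recr//= mulrDr IH exprS; ring.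
Qed.

Lemma dker_decay n t : cmod (1 - z2 t) * cmod (dker n t) <= 2.
Proof.
rewrite -normcM dker_telescope.
apply: le_trans (le_normcD _ _) _.
by rewrite normcN normc1 cmodX cmod_z2 expr1n.
Qed.

(** D_n differs from n by the sum of 1 - z^k, and |1 - z^k| <= k |1 - z|. *)
Lemma dker_ge n t : n%:R * cmod (1 - z2 t) <= 2^-1 -> n%:R / 2 <= cmod (dker n t).
Proof.
move=> nd.
have H : cmod (n%:R - dker n t) <= n%:R / 2.
  have -> : n%:R - dker n t = \sum_(0 <= k < n) (1 - z2 t ^+ k).
    by rewrite sumrB sumr_const_nat subn0.
  apply: le_trans (cmod_sum_le _ _ _) _.
  apply: (@le_trans _ _ (\sum_(0 <= k < n) 2^-1)); last first.
    by rewrite sumr_const_nat subn0 mulr_natl.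
  apply: ler_sum_nat => k /andP[_ kn].
  have z1 : cmod (z2 t) <= 1 by rewrite cmod_z2.
  apply: le_trans (cmod_onemX_le _ z1) _; apply: le_trans nd.
  by rewrite ler_wpM2r ?cmod_ge0// ler_nat ltnW.
have : cmod (n%:R : R[i]) <= cmod (n%:R - dker n t) + cmod (dker n t).
  by apply: le_trans (le_normcD _ _); rewrite subrK.
have -> : cmod (n%:R : R[i]) = n%:R.
  by rewrite -[n%:R](rmorph_nat (real_complex R)) cmod_real ger0_norm.
lra.
Qed.

(** The scale 2^j is the last one, up to 2^m, at which 2^j |1 - z| <= 1/2 (or
j = 0 if there is none, and D_1 = 1), so that D_(2^j) has not started to
oscillate; unless j = m, the size of D is then at most
2 / |1 - z| < 8 * 2^j. *)
Lemma dker_dyadic m (y : R) t :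
  y <= 8 * 2 ^+ m -> cmod (1 - z2 t) * y <= 2 ->
  exists j : nat, [/\ (j <= m)%N, y <= 8 * 2 ^+ j & 2 ^+ j / 2 <= cmod (dker (2 ^ j) t)].
Proof.
move=> + yd; elim: m => [|m IH] ym.
  exists 0%N; split=> //; rewrite /dker big_nat1 !expr0 normc1; lra.
have [small|large] := lerP (2 ^+ m.+1 * cmod (1 - z2 t)) 2^-1.
  exists m.+1; split=> //.
  by rewrite -natrX; apply: dker_ge; rewrite natrX.
have [|j [jm ? ?]] := IH; last by exists j; split => //; exact: leqW.
rewrite leNgt; apply/negP => yl.
have : cmod (1 - z2 t) * (8 * 2 ^+ m) <= cmod (1 - z2 t) * y.
  by rewrite ler_wpM2l ?cmod_ge0// ltW.
by move: large; rewrite exprS; lra.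
Qed.

(** At the scale of [dker_dyadic], |D|^p <= 8^p 2^(jp) and
2^(2j) <= 4 |D_(2^j)|^2; the sum over all j makes the bound independent of the
point.  The functions |D_(2^j)|^2 are multiples of Fejer kernels, of mean 2^j. *)
Lemma dker_powR_le m (p : R) t : 1 <= p ->
  cmod (dker (2 ^ m) t) `^ p <=
  \sum_(0 <= j < m.+1) (4 * 8 `^ p * (2 ^+ j) `^ (p - 2)) * csq (dker (2 ^ j) t).
Proof.
move=> p1; have p0 : 0 <= p by lra.
have ub : cmod (dker (2 ^ m) t) <= 8 * 2 ^+ m.
  apply: le_trans (cmod_dker_le _ _) _; rewrite natrX ler_peMl ?exprn_ge0//; lra.
have [j [jm yj dj]] := dker_dyadic ub (dker_decay _ _).
rewrite (big_cat_nat (n := j))//=; last exact: leqW.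
rewrite [X in _ <= _ + X]big_ltn// addrCA.
have nn k : 0 <= (4 * 8 `^ p * (2 ^+ k) `^ (p - 2)) * csq (dker (2 ^ k) t).
  by rewrite !mulr_ge0 ?powR_ge0 ?csq_ge0.
apply: (@le_trans _ _ ((4 * 8 `^ p * (2 ^+ j) `^ (p - 2)) * csq (dker (2 ^ j) t))); last first.
  by rewrite lerDl addr_ge0// sumr_ge0.
have x0 : 0 < 2 ^+ j :> R by rewrite exprn_gt0.
apply: (@le_trans _ _ ((8 * 2 ^+ j) `^ p)).
  by apply: ge0_ler_powR => //; rewrite nnegrE ?cmod_ge0// mulr_ge0// ltW.
rewrite powRM ?(ltW x0)//.
have -> : (2 ^+ j) `^ p = (2 ^+ j) `^ (p - 2) * (2 ^+ j) ^+ 2 :> R.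
  rewrite -[X in _ = _ * X]powR_mulrn ?ltW// -powRD ?subrK//.
  by rewrite (gt_eqF x0) implybT.
rewrite [4 * _]mulrC -!mulrA ler_wpM2l ?powR_ge0//.
rewrite [leRHS]mulrCA ler_wpM2l ?powR_ge0//.
rewrite -sqr_cmod -ler_pdivrMl//.
have -> : 4^-1 * (2 ^+ j) ^+ 2 = (2 ^+ j / 2) ^+ 2 :> R by field.
by rewrite lerXn2r// nnegrE ?cmod_ge0// divr_ge0// ltW.
Qed.

Lemma mean_dker_powR_le m (p M : R) : 1 <= p ->
  has_mean (fun t => cmod (dker (2 ^ m) t) `^ p) M ->
  M <= 4 * 8 `^ p * \sum_(0 <= j < m.+1) (2 ^+ j) `^ (p - 1).
Proof.
move=> p1 hM.
have h : has_mean (fun t => \sum_(0 <= j < m.+1)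
    (4 * 8 `^ p * (2 ^+ j) `^ (p - 2)) * csq (dker (2 ^ j) t))
    (\sum_(0 <= j < m.+1) (4 * 8 `^ p * (2 ^+ j) `^ (p - 2)) * (2 ^ j)%:R).
  by apply: has_mean_sum => j; apply: has_meanZ; exact: mean_csq_dker.
apply: le_trans (le_has_mean hM h (fun t => dker_powR_le m t p1)) _.
rewrite mulr_sumr; apply: ler_sum => j _.
have x0 : 0 < 2 ^+ j :> R by rewrite exprn_gt0.
have -> : p - 1 = (p - 2) + 1 by ring.
rewrite (@powRD _ (2 ^+ j) (p - 2) 1) ?powRr1 ?(ltW x0)//; last by rewrite (gt_eqF x0) implybT.
by rewrite natrX !mulrA.
Qed.

Lemma mean_dker_p1 m (M : R) :
  has_mean (fun t => cmod (dker (2 ^ m) t) `^ 1) M -> M <= 32 * m.+1%:R.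
Proof.
move=> /(mean_dker_powR_le (lexx 1)); rewrite subrr powRr1//.
under eq_bigr do rewrite powRr0.
by rewrite sumr_const_nat subn0; lra.
Qed.

Lemma sum_geometric_le (r : R) m : 1 < r ->
  \sum_(0 <= j < m.+1) r ^+ j <= r / (r - 1) * r ^+ m.
Proof.
move=> r1; have d0 : 0 < r - 1 by rewrite subr_gt0.
have H : (r - 1) * \sum_(0 <= j < m.+1) r ^+ j = r ^+ m.+1 - 1.
  elim: m => [|m IH]; first by rewrite big_nat1 expr0 mulr1 expr1.
  by rewrite big_nat_recr//= mulrDr IH !exprS; ring.
rewrite -(ler_pM2l d0) H exprS.
have -> : (r - 1) * (r / (r - 1) * r ^+ m) = r * r ^+ m by field; rewrite gt_eqF.
by rewrite gerBl.
Qed.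

Lemma mean_dker_p p : 1 < p -> exists2 C : R, 0 < C & forall m M,
  has_mean (fun t => cmod (dker (2 ^ m) t) `^ p) M -> M <= C * (2 ^+ m) `^ (p - 1).
Proof.
move=> p1; pose r : R := 2 `^ (p - 1).
have r1 : 1 < r.
  have h : 0 < p - 1 by rewrite subr_gt0.
  rewrite -(powRr0 2) /r /powR; case: ifPn => [/eqP|_]; first by lra.
  by rewrite ltr_expR mul0r mulr_gt0// ln_gt0//; lra.
have rj j : (2 ^+ j) `^ (p - 1) = r ^+ j.
  by rewrite -powR_mulrn// -powRrM mulrC powRrM -powR_mulrn ?powR_ge0.
exists (4 * 8 `^ p * (r / (r - 1))).
  by rewrite !mulr_gt0 ?powR_gt0// ?invr_gt0; lra.
move=> m M /(mean_dker_powR_le (ltW p1)) /le_trans; apply.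
under eq_bigr do rewrite rj.
rewrite rj -[leRHS]mulrA ler_wpM2l ?mulr_ge0 ?powR_ge0//.
exact: sum_geometric_le.
Qed.

End Periodic.

(** * Lacunary polynomials and Riesz products *)

Section Lacunary.
Variable R : realType.
Local Notation Re := (@complex.Re R).
Local Notation Im := (@complex.Im R).
Local Notation z2 := (@z2 R).

Lemma expR_le_quad (x : R) : -2^-1 <= x <= 2^-1 -> expR x <= 1 + x + 2 * x ^+ 2.
Proof.
move=> /andP[x1 x2].
have h : 1 - x <= (expR x)^-1 by rewrite -expRN; have := expR_ge1Dx (- x); lra.
have e0 := expR_gt0 x.
have h2 : (1 - x) * expR x <= 1 by rewrite -ler_pdivlMr// mul1r.
have h3 : 1 <= (1 - x) * (1 + x + 2 * x ^+ 2).
  have -> : (1 - x) * (1 + x + 2 * x ^+ 2) = 1 + x ^+ 2 * (1 - 2 * x) by ring.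
  by rewrite lerDl mulr_ge0 ?sqr_ge0//; lra.
have d0 : 0 < 1 - x by lra.
by rewrite -(ler_pM2l d0); apply: le_trans h3.
Qed.

(** The factors have mean 1 and, thanks to the lacunary exponents, so does their
product, as if they were independent. *)
Definition riesz (c : R) (u : R[i]) (N : nat) (t : R) : R :=
  \prod_(0 <= k < N) (1 + c * Re (u * z2 t ^+ (3 ^ k))).

Definition int_freq (n : int) (x : R) : Prop := x = - ln 2 * n%:~R.

Lemma trig_z2X (P : R -> Prop) c n : P (- ln 2 * n%:R) ->
  trig P (fun t => c * z2 t ^+ n).
Proof.
move=> Pn; have := @trig_char _ P c _ Pn; congr (trig P _).
by apply/funext => t; rewrite z2E cisX; congr (_ * cis _); ring.
Qed.

(** A signed sum of distinct powers of 3 below 3^N is less than 3^N / 2 in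
absolute value; adding it to 3^N or to - 3^N gives a nonzero integer of absolute
value less than 3^(N+1) / 2. *)
Lemma trig_riesz c u N :
  trig (fun x => exists n : int, [/\ n != 0, `|n| * 2 < (3 ^ N)%:R & int_freq n x])
    (fun t => (riesz c u N t - 1)%:C).
Proof.
elim: N => [|N IH].
  rewrite (_ : (fun _ => _) = fun=> 0); first exact: trig0.
  by apply/funext => t; rewrite /riesz big_geq// subrr.
set P := (fun _ => _) in IH; set P' := (fun _ => _).
have PP' x : P x -> P' x.
  by move=> [n [n0 n1 xn]]; exists n; split => //; rewrite expnS; lia.
pose S (x : R) := exists n : int, `|n| * 2 < (3 ^ N)%:R /\ int_freq n x.
pose Q (x : R) := exists n : int, `|n| = (3 ^ N)%:R /\ int_freq n x.
have h1 : trig S (fun t => (riesz c u N t)%:C).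
  rewrite (_ : (fun _ => _) = fun t => 1 + (riesz c u N t - 1)%:C).
    apply: trigD.
      apply: trig_cst; exists 0; split; last by rewrite /int_freq mulr0.
      by rewrite normr0 mul0r ltr0n expn_gt0.
    by apply: trig_sub IH => x [n [_ n1 xn]]; exists n.
  by apply/funext => t; rewrite -[1](rmorph1 (real_complex R)) -rmorphD addrC subrK.
have h2 : trig Q (fun t => (c * Re (u * z2 t ^+ (3 ^ N)))%:C).
  rewrite (_ : (fun _ => _) = fun t =>
      (c / 2)%:C * (u * z2 t ^+ (3 ^ N) + (u * z2 t ^+ (3 ^ N))^*)).
    apply: trigZ; apply: trigD.
      by apply: trig_z2X; exists (3 ^ N)%:R; split; rewrite ?normr_nat// /int_freq rmorph_nat.
    apply: (@trig_sub _ (fun x => exists n : int, n = (3 ^ N)%:R /\ int_freq n (- x))).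
      move=> x [n [n1 xn]]; exists (- n); split; first by rewrite normrN n1; lia.
      by rewrite /int_freq rmorphN/= mulrN -xn opprK.
    apply: (@trig_conj _ (fun x => exists n : int, n = (3 ^ N)%:R /\ int_freq n x)).
    by apply: trig_z2X; exists (3 ^ N)%:R; split => //; rewrite /int_freq rmorph_nat.
  apply/funext => t; case: (u * _) => x y.
  by apply/eqP; rewrite eq_complex/=; apply/andP; split; apply/eqP; lra.
rewrite (_ : (fun _ => _) = fun t => (riesz c u N t - 1)%:C +
   (c * Re (u * z2 t ^+ (3 ^ N)))%:C * (riesz c u N t)%:C).
  apply: trigD; first exact: trig_sub IH.
  apply: (trigM _ h2 h1) => x y [n [n1 xn]] [k [k1 yk]].
  exists (n + k); split.
  - by apply/eqP; lia.
  - by rewrite expnS; lia.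
  - by rewrite /int_freq rmorphD mulrDr -xn -yk.
apply/funext => t; rewrite -rmorphM -rmorphD; congr (_%:C).
by rewrite /riesz big_nat_recr//=; ring.
Qed.

Lemma mean_riesz c u N : has_mean (riesz c u N) 1.
Proof.
have -> : riesz c u N = fun t => 1 + (riesz c u N t - 1).
  by apply/funext => t; rewrite addrC subrK.
rewrite -[X in has_mean _ X]addr0; apply: has_meanD; first exact: has_mean_cst.
apply: (trig_mean0 (trig_riesz c u N)) => -[n [n0 _]].
rewrite /int_freq => /esym/eqP; rewrite mulf_eq0 oppr_eq0 intr_eq0 (negbTE n0) orbF.
by rewrite gt_eqF// ln_gt0// ltr1n.
Qed.

Definition lac (N : nat) (t : R) : R[i] := \sum_(0 <= k < N) z2 t ^+ (3 ^ k).

(** For each term, exp (y v) <= 1 + y v + 2 y^2 = (1 + 2 y^2) (1 + c v) with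
c = y / (1 + 2 y^2) and v the real part of a unimodular number. *)
Lemma expR_lac_le (y : R) u N t : 0 <= y <= 2^-1 -> cmod u = 1 ->
  expR (y * Re (u * lac N t)) <= expR (2 * N%:R * y ^+ 2) * riesz (y / (1 + 2 * y ^+ 2)) u N t.
Proof.
move=> /andP[y0 y1] u1.
elim: N => [|N IH].
  by rewrite /lac /riesz !big_geq// mulr1 !mulr0 mul0r.
have -> : riesz (y / (1 + 2 * y ^+ 2)) u N.+1 t =
    riesz (y / (1 + 2 * y ^+ 2)) u N t * (1 + y / (1 + 2 * y ^+ 2) * Re (u * z2 t ^+ (3 ^ N))).
  by rewrite /riesz big_nat_recr.
have -> : lac N.+1 t = lac N t + z2 t ^+ (3 ^ N) by rewrite /lac big_nat_recr.
rewrite mulrDr ReD mulrDr expRD.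
have -> : 2 * N.+1%:R * y ^+ 2 = 2 * N%:R * y ^+ 2 + 2 * y ^+ 2 by rewrite -natr1; ring.
rewrite expRD; set v := Re (u * _ ^+ _); set a := expR (2 * N%:R * _).
set b := expR (2 * _); set r := riesz _ _ _ _; set w := 1 + _ * v.
have -> : a * b * (r * w) = a * r * (b * w) by ring.
have v1 : `|v| <= 1.
  have : csq (u * z2 t ^+ (3 ^ N)) = 1.
    by rewrite csqM -!sqr_cmod u1 cmodX cmod_z2 !expr1n mulr1.
  rewrite /csq -/v => h; have : v ^+ 2 <= 1 by rewrite -h lerDl sqr_ge0.
  by rewrite -real_normK ?num_real// expr_le1.
have d0 : 0 < 1 + 2 * y ^+ 2 by rewrite ltr_wpDr// mulr_ge0// sqr_ge0.
have yv : -2^-1 <= y * v <= 2^-1.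
  by move: v1; rewrite ler_norml => /andP[? ?]; apply/andP; split; nra.
apply: ler_pM; rewrite ?expR_ge0// /b /w.
apply: le_trans (expR_le_quad yv) _.
apply: (@le_trans _ _ ((1 + 2 * y ^+ 2) * (1 + y / (1 + 2 * y ^+ 2) * v))).
  have -> : (1 + 2 * y ^+ 2) * (1 + y / (1 + 2 * y ^+ 2) * v) = 1 + 2 * y ^+ 2 + y * v.
    by field; rewrite gt_eqF.
  have : (y * v) ^+ 2 <= y ^+ 2.
    rewrite exprMn ler_piMr ?sqr_ge0//.
    by rewrite -real_normK ?num_real// expr_le1.
  lra.
rewrite ler_wpM2r ?expR_ge1Dx//.
have -> : y / (1 + 2 * y ^+ 2) * v = (y * v) / (1 + 2 * y ^+ 2) by ring.
have : -2^-1 <= (y * v) / (1 + 2 * y ^+ 2); last lra.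
rewrite ler_pdivlMr//; have := sqr_ge0 y; lra.
Qed.

Lemma powR_le_expR (p y : R) : 0 < p -> 0 <= y -> y `^ p <= p `^ p * expR y.
Proof.
move=> p0 y0.
have yp0 : 0 <= y / p by rewrite divr_ge0// ltW.
have -> : y = p * (y / p) by rewrite mulrC mulfVK// gt_eqF.
rewrite powRM ?(ltW p0)// ler_wpM2l ?powR_ge0//.
rewrite [p * (y / p)]mulrC expRM; apply: ge0_ler_powR; rewrite ?nnegrE ?expR_ge0//.
  exact: ltW.
by have := expR_ge1Dx (y / p); lra.
Qed.

(** The modulus of z is at most twice the largest of Re z, - Re z, Im z,
- Im z. *)
Lemma cmod_le_max4 (z : R[i]) (y : R) : 0 <= y ->
  expR (y * cmod z) <= expR (2 * y * Re (1 * z)) + expR (2 * y * Re (-1 * z)) +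
    (expR (2 * y * Re ('i * z)) + expR (2 * y * Re (- 'i * z))).
Proof.
move=> y0.
have cz : cmod z <= `|Re z| + `|Im z|.
  have h : 0 <= `|Re z| + `|Im z| by rewrite addr_ge0.
  rewrite -(ler_pXn2r (n := 2))// ?nnegrE ?cmod_ge0// sqr_cmod /csq sqrrD !real_normK ?num_real//.
  by rewrite -addrA [_ *+ 2 + _]addrC addrA lerDl mulrn_wge0// mulr_ge0.
have e : forall x : R, 0 <= expR x by move=> x; exact: expR_ge0.
have key (x w : R) : `|w| <= `|x| -> cmod z <= 2 * `|x| ->
   expR (y * cmod z) <= expR (2 * y * x) + expR (2 * y * - x).
  move=> _ cx; have [x0|x0] := lerP 0 x.
    apply: ler_wpDr; rewrite ?e// ler_expR (mulrC 2) -mulrA ler_wpM2l//.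
    by rewrite -(ger0_norm x0).
  apply: ler_wpDl; rewrite ?e// ler_expR (mulrC 2) -mulrA ler_wpM2l//.
  by rewrite -(ltr0_norm x0).
have -> : Re (1 * z) = Re z by rewrite mul1r.
have -> : Re (-1 * z) = - Re z by rewrite mulN1r ReN.
have -> : Re ('i * z) = - Im z by case: z {cz key} => a b /=; ring.
have -> : Re (- 'i * z) = - - Im z by case: z {cz key} => a b /=; ring.
have [h|h] := lerP `|Im z| `|Re z|.
  apply: ler_wpDr; rewrite ?addr_ge0 ?e//.
  by apply: (key _ (Im z)) => //; lra.
apply: ler_wpDl; rewrite ?addr_ge0 ?e//.
by apply: (key _ (Re z)); rewrite normrN; lra.
Qed.

(** With y = 1 / (2 sqrt N) the exponential moments of y Re (u f) are at most
exp (1/2), for u = 1, -1, i, -i; and a power is dominated by an exponential. *)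
Lemma mean_lac_le (p : R) : 0 < p -> exists2 C : R, 0 < C & forall N M, (0 < N)%N ->
  has_mean (fun t => cmod (lac N t) `^ p) M -> M <= C * N%:R `^ (p / 2).
Proof.
move=> p0.
exists ((4 * p) `^ p * (4 * expR 2^-1)).
  by rewrite !mulr_gt0 ?powR_gt0 ?expR_gt0 ?mulr_gt0.
move=> N M N0 hM.
have NR : 0 < N%:R :> R by rewrite ltr0n.
pose s : R := Num.sqrt N%:R.
have s0 : 0 < s by rewrite sqrtr_gt0.
have s1 : 1 <= s by rewrite /s -[leLHS]sqrtr1 ler_sqrt// ler1n.
have s2 : s ^+ 2 = N%:R by rewrite sqr_sqrtr// ltW.
pose y := (2 * s)^-1.
have y0 : 0 < y by rewrite invr_gt0 mulr_gt0.
have y01 : 0 <= y <= 2^-1.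
  by rewrite ltW//= lef_pV2 ?posrE ?mulr_gt0//; lra.
pose c := y / (1 + 2 * y ^+ 2).
pose K := (4 * p * s) `^ p.
have Nsp : N%:R `^ (p / 2) = s `^ p.
  by rewrite /s -powR12_sqrt ?ltW// -powRrM mulrC.
have pt t : cmod (lac N t) `^ p <= K * expR 2^-1 *
   (riesz c 1 N t + riesz c (-1) N t + (riesz c 'i N t + riesz c (- 'i) N t)).
  have c0 := cmod_ge0 (lac N t).
  have yc0 : 0 <= y / 2 * cmod (lac N t) by rewrite mulr_ge0// divr_ge0// ltW.
  have -> : cmod (lac N t) `^ p = (4 * s) `^ p * (y / 2 * cmod (lac N t)) `^ p.
    rewrite -powRM//; last by rewrite mulr_ge0// ltW.
    by congr powR; rewrite /y; field; rewrite gt_eqF.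
  have -> : K = (4 * s) `^ p * p `^ p.
    by rewrite /K [4 * p * s]mulrAC (@powRM _ (4 * s) p p _ (ltW p0))//; rewrite mulr_ge0// ltW.
  rewrite -[leRHS]mulrA -[leRHS]mulrA ler_wpM2l ?powR_ge0//.
  apply: le_trans (powR_le_expR p0 yc0) _; rewrite ler_wpM2l ?powR_ge0//.
  apply: le_trans (cmod_le_max4 _ _) _; first by rewrite divr_ge0// ltW.
  have -> : 2 * (y / 2) = y by field.
  have NE : 2 * N%:R * y ^+ 2 = 2^-1.
    by rewrite -s2 /y; field; rewrite gt_eqF.
  have ineq u : cmod u = 1 -> expR (y * Re (u * lac N t)) <= expR 2^-1 * riesz c u N t.
    by move=> u1; rewrite -{1}NE; exact: expR_lac_le.
  have ci : cmod ('i : R[i]) = 1 by rewrite cmodE /csq /= expr0n add0r expr1n sqrtr1.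
  rewrite !mulrDr; apply: lerD; apply: lerD; apply: ineq => //.
  - by rewrite normc1.
  - by rewrite normcN normc1.
  - by rewrite normcN.
have hR := has_meanZ (K * expR 2^-1) (has_meanD
  (has_meanD (mean_riesz c 1 N) (mean_riesz c (-1) N))
  (has_meanD (mean_riesz c 'i N) (mean_riesz c (- 'i) N))).
apply: le_trans (le_has_mean hM hR pt) _.
rewrite Nsp /K (@powRM _ (4 * p) s p _ (ltW s0)); last by rewrite mulr_ge0// ltW.
by rewrite le_eqVlt; apply/orP; left; apply/eqP; ring.
Qed.

(** Passing from (P, Q) to (P + w^(2^n) Q, P - w^(2^n) Q) doubles the length
and, by the parallelogram identity, |P|^2 + |Q|^2. *)
Lemma rudin_shapiro n : exists p q : nat -> R[i],
  [/\ forall k, cmod (p k) = 1, forall k, cmod (q k) = 1 & forall w : R[i], cmod w = 1 ->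
  csq (\sum_(0 <= k < 2 ^ n) p k * w ^+ k) + csq (\sum_(0 <= k < 2 ^ n) q k * w ^+ k) =
  2 * 2 ^+ n].
Proof.
elim: n => [|n [p [q [p1 q1 H]]]].
  exists (fun=> 1), (fun=> 1); split => [k|k|w w1]; rewrite ?normc1//.
  by rewrite !big_nat1 !mul1r !expr0 /csq/=; ring.
pose r (s : R[i]) k := if (k < 2 ^ n)%N then p k else s * q (k - 2 ^ n)%N.
exists (r 1), (r (-1)); split => [k|k|w w1].
- by rewrite /r; case: ifP; rewrite ?mul1r.
- by rewrite /r; case: ifP; rewrite ?mulN1r ?normcN.
have rE s : \sum_(0 <= k < 2 ^ n.+1) r s k * w ^+ k =
    \sum_(0 <= k < 2 ^ n) p k * w ^+ k +
    s * (w ^+ (2 ^ n) * \sum_(0 <= k < 2 ^ n) q k * w ^+ k).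
  rewrite (big_cat_nat (n := (2 ^ n)%N))//=; last by rewrite leq_exp2l.
  congr (_ + _).
    by apply: eq_big_nat => k /andP[_ kn]; rewrite /r kn.
  rewrite -{1}[(2 ^ n)%N]add0n big_addn expnS mul2n -addnn addnK !mulr_sumr.
  apply: eq_bigr => k _; rewrite /r ltnNge leq_addl/= addnK exprD; ring.
rewrite !rE mulN1r mul1r.
have := H w w1; set P := \sum_(_ <= _ < _) _; set Q := \sum_(_ <= _ < _) _.
have : csq (w ^+ (2 ^ n) * Q) = csq Q.
  by rewrite csqM -sqr_cmod cmodX w1 !expr1n mul1r.
set T := _ * Q => TQ; rewrite -TQ exprS.
case: P T {TQ} => a b [c d]; rewrite /csq /= => h.
by transitivity (2 * (a ^+ 2 + b ^+ 2 + (c ^+ 2 + d ^+ 2))); [ring|rewrite h; ring].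
Qed.

End Lacunary.

(** * Democracy functions as extremal values *)

Section Assembly.
Variable R : realType.
Implicit Types (A : {fset nat}) (e : nat -> R[i]).

Definition admissible A e := 0%N \notin A /\ unimodular_on A e.

Lemma admissible1 A : 0%N \notin A -> admissible A (fun=> 1).
Proof. by move=> A0; split => //; exact: unimodular1. Qed.

Lemma phi_lE_ge (p : \bar R) N c :
  (forall A e, admissible A e -> (N <= #|` A|)%N -> c <= Hnorm p A e) ->
  c <= phi_lE R p N.
Proof.
move=> H; apply: lb_le_inf.
  exists (Hnorm p (pow2set id N) (fun=> 1)), (pow2set id N), (fun=> 1).
  split=> //; [exact: pow2set0|by rewrite card_pow2set|exact: unimodular1].
by move=> x [A [e [A0 AN e1 ->]]]; exact: H.
Qed.

Lemma phi_l_ge (p : \bar R) N c :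
  (forall A, 0%N \notin A -> (N <= #|` A|)%N -> c <= Hnorm p A (fun=> 1)) ->
  c <= phi_l R p N.
Proof.
move=> H; apply: lb_le_inf.
  exists (Hnorm p (pow2set id N) (fun=> 1)), (pow2set id N).
  split=> //; [exact: pow2set0|by rewrite card_pow2set].
by move=> x [A [A0 AN ->]]; exact: H.
Qed.

Lemma phi_lE_le (p : \bar R) N c A e :
  (forall A e, admissible A e -> 0 <= Hnorm p A e) ->
  admissible A e -> (N <= #|` A|)%N -> Hnorm p A e <= c -> phi_lE R p N <= c.
Proof.
move=> H0 [A0 e1] AN; apply: le_trans; apply: ge_inf; last by exists A, e.
by exists 0 => x [A' [e' [A0' AN' e1' ->]]]; exact: H0.
Qed.

Lemma phi_l_le (p : \bar R) N c A :
  (forall A e, admissible A e -> 0 <= Hnorm p A e) ->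
  0%N \notin A -> (N <= #|` A|)%N -> Hnorm p A (fun=> 1) <= c -> phi_l R p N <= c.
Proof.
move=> H0 A0 AN; apply: le_trans; apply: ge_inf; last by exists A.
by exists 0 => x [A' [A0' AN' ->]]; apply: H0; exact: admissible1.
Qed.

Lemma phi_lE_le_l (p : \bar R) N :
  (forall A e, admissible A e -> 0 <= Hnorm p A e) ->
  phi_lE R p N <= phi_l R p N.
Proof.
move=> H0; apply: phi_l_ge => A A0 AN.
by apply: (phi_lE_le H0 (admissible1 A0)).
Qed.

Lemma phi_uE_le (p : \bar R) N c :
  (forall A e, admissible A e -> (#|` A| <= N)%N -> Hnorm p A e <= c) ->
  phi_uE R p N <= c.
Proof.
move=> H; apply: ge_sup.
  exists (Hnorm p fset0 (fun=> 1)), fset0, (fun=> 1).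
  by split; rewrite ?inE ?cardfs0//; exact: unimodular1.
by move=> x [A [e [A0 AN e1 ->]]]; exact: H.
Qed.

Lemma phi_u_ge (p : \bar R) N c B A :
  (forall A e, admissible A e -> (#|` A| <= N)%N -> Hnorm p A e <= B) ->
  0%N \notin A -> (#|` A| <= N)%N -> c <= Hnorm p A (fun=> 1) -> c <= phi_u R p N.
Proof.
move=> HB A0 AN cA; apply: le_trans cA _; apply: ub_le_sup; last by exists A.
by exists B => x [A' [A0' AN' ->]]; apply: HB => //; exact: admissible1.
Qed.

Lemma phi_u_le_uE (p : \bar R) N B :
  (forall A e, admissible A e -> (#|` A| <= N)%N -> Hnorm p A e <= B) ->
  phi_u R p N <= phi_uE R p N.
Proof.
move=> HB; apply: ge_sup.
  exists (Hnorm p fset0 (fun=> 1)), fset0.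
  by split; rewrite ?inE ?cardfs0.
move=> x [A [A0 AN ->]]; apply: ub_le_sup.
  by exists B => x' [A' [e' [A0' AN' e1' ->]]]; exact: HB.
by exists A, (fun=> 1); split => //; exact: unimodular1.
Qed.

(** A bound for all unimodular coefficients and a single good set without
coefficients suffice, since the super-democracy function is the smaller one. *)
Lemma lower_democracy (p : \bar R) N0 (g : nat -> R) c C : 0 < c -> 0 < C ->
  (forall A e, admissible A e -> 0 <= Hnorm p A e) ->
  (forall N A e, (N0 <= N)%N -> admissible A e -> (N <= #|` A|)%N ->
     g N <= c * Hnorm p A e) ->
  (forall N, (N0 <= N)%N -> exists A,
     [/\ 0%N \notin A, (N <= #|` A|)%N & Hnorm p A (fun=> 1) <= C * g N]) ->
  approx_from N0 (phi_l R p) (phi_lE R p) /\ approx_from N0 (phi_lE R p) g.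
Proof.
move=> c0 C0 H0 Hl Hu.
have gE N : (N0 <= N)%N -> g N <= c * phi_lE R p N.
  move=> hN; rewrite -ler_pdivrMl//; apply: phi_lE_ge => A e Ae AN.
  by rewrite ler_pdivrMl//; exact: Hl.
have lg N : (N0 <= N)%N -> phi_l R p N <= C * g N.
  by move=> hN; have [A [A0 AN HA]] := Hu _ hN; exact: (phi_l_le H0 A0).
have El N := phi_lE_le_l N H0.
split; split.
- exists (C * c); first exact: mulr_gt0.
  move=> N hN; apply: le_trans (lg _ hN) _; rewrite -mulrA ler_wpM2l ?gE//; exact: ltW.
- by exists 1 => // N hN; rewrite mul1r.
- by exists C => // N hN; apply: le_trans (El N) (lg _ hN).
- by exists c.
Qed.

Lemma upper_democracy (p : \bar R) N0 (g : nat -> R) c C : 0 < c -> 0 < C ->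
  (forall N A e, (N0 <= N)%N -> admissible A e -> (#|` A| <= N)%N ->
     Hnorm p A e <= C * g N) ->
  (forall N, (N0 <= N)%N -> exists A,
     [/\ 0%N \notin A, (#|` A| <= N)%N & g N <= c * Hnorm p A (fun=> 1)]) ->
  approx_from N0 (phi_u R p) (phi_uE R p) /\ approx_from N0 (phi_uE R p) g.
Proof.
move=> c0 C0 Hu Hl.
have HB N (hN : (N0 <= N)%N) := fun A e => Hu N A e hN.
have Eg N : (N0 <= N)%N -> phi_uE R p N <= C * g N.
  by move=> hN; apply: phi_uE_le; exact: HB.
have gu N : (N0 <= N)%N -> g N <= c * phi_u R p N.
  move=> hN; have [A [A0 AN HA]] := Hl _ hN; rewrite -ler_pdivrMl//.
  by apply: (phi_u_ge (HB _ hN) A0 AN); rewrite ler_pdivrMl.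
have uE N (hN : (N0 <= N)%N) := phi_u_le_uE (HB _ hN).
split; split.
- by exists 1 => // N hN; rewrite mul1r; exact: uE.
- exists (C * c); first exact: mulr_gt0.
  move=> N hN; apply: le_trans (Eg _ hN) _; rewrite -mulrA ler_wpM2l ?gu//; exact: ltW.
- by exists C.
- by exists c => // N hN; apply: le_trans (gu _ hN) _; rewrite ler_wpM2l ?uE//; exact: ltW.
Qed.

(** * Bounds valid for all sets *)

Lemma Hnorm_fin_ge0 (p : R) A e : 0 <= Hnorm p%:E A e.
Proof. exact: powR_ge0. Qed.

Lemma Hnorm_fin_le (p a K x M : R) A e : 0 < p -> 0 < K -> 0 < x ->
  has_mean (fun t => cmod (dirichlet_poly A e t) `^ p) M ->
  M <= K * x `^ (a * p) -> Hnorm p%:E A e <= K `^ p^-1 * x `^ a.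
Proof.
move=> p0 K0 x0 hM ML; rewrite /= (has_mean_Hnorm_fin hM).
have M0 : 0 <= M.
  by apply: (le_has_mean (has_mean_cst 0) hM) => t; exact: powR_ge0.
apply: (@le_trans _ _ ((K * x `^ (a * p)) `^ p^-1)).
  by apply: ge0_ler_powR; rewrite ?nnegrE ?invr_ge0 ?mulr_ge0 ?powR_ge0 ?(ltW p0) ?(ltW K0).
by rewrite powRM ?powR_ge0 ?(ltW K0)// -powRrM mulfK// gt_eqF.
Qed.

Lemma Hnorm_fin_ge (p a K x M : R) A e : 0 < p -> 0 < K -> 0 < x ->
  has_mean (fun t => cmod (dirichlet_poly A e t) `^ p) M ->
  x `^ (a * p) <= K * M -> x `^ a <= K `^ p^-1 * Hnorm p%:E A e.
Proof.
move=> p0 K0 x0 hM ML; rewrite /= (has_mean_Hnorm_fin hM).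
have M0 : 0 <= M.
  by apply: (le_has_mean (has_mean_cst 0) hM) => t; exact: powR_ge0.
have -> : x `^ a = (x `^ (a * p)) `^ p^-1 by rewrite -powRrM mulfK// gt_eqF.
rewrite -powRM ?(ltW K0)//; apply: ge0_ler_powR => //;
  by rewrite ?nnegrE ?invr_ge0 ?mulr_ge0 ?powR_ge0 ?(ltW p0) ?(ltW K0).
Qed.

Lemma cmod_dirichlet_le A e t : unimodular_on A e ->
  cmod (dirichlet_poly A e t) <= #|` A|%:R.
Proof.
move=> e1; apply: le_trans (cmod_sum_le _ _ _) _.
rewrite (@eq_big_seq _ _ _ _ _ _ (fun=> 1 : R)); last first.
  by move=> n nA /=; rewrite normcM e1// nat_pow_mitE cmod_cis mulr1.
by rewrite big_const_seq count_predT iter_addr_0.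
Qed.

(** Bernoulli with exponent p/2 <= 1 for |f|^2 / N, whose mean is at most 1. *)
Lemma mean_powR_le2 (p M : R) A e N : 0 < p -> p <= 2 -> (0 < N)%N ->
  admissible A e -> (#|` A| <= N)%N ->
  has_mean (fun t => cmod (dirichlet_poly A e t) `^ p) M -> M <= N%:R `^ (p / 2).
Proof.
move=> p0 p2 N0 [A0 e1] AN hM; have NR : 0 < N%:R :> R by rewrite ltr0n.
have q0 : 0 < p / 2 by rewrite divr_gt0.
have q1 : p / 2 <= 1 by rewrite ler_pdivrMr// mul1r.
have h := has_meanZ (N%:R `^ (p / 2)) (has_meanD (has_mean_cst (1 - p / 2))
  (has_meanZ (p / 2 / N%:R) (mean_csq_dirichlet A0 e1))).
have := le_has_mean hM h => /(_ _)/le_trans; apply => [t|].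
  rewrite cmod_powR; set c := csq _.
  have c0 : 0 <= c / N%:R by rewrite divr_ge0 ?csq_ge0// ltW.
  have -> : c = N%:R * (c / N%:R) by rewrite mulrC mulfVK// gt_eqF.
  rewrite powRM ?(ltW NR)// ler_wpM2l ?powR_ge0//.
  apply: le_trans (powR_bernoulli_le q0 q1 c0) _.
  rewrite le_eqVlt; apply/orP; left; apply/eqP; field; by rewrite gt_eqF.
rewrite ler_piMr ?powR_ge0//.
have : p / 2 / N%:R * #|` A|%:R <= p / 2.
  by rewrite -mulrA ler_piMr ?(ltW q0)// ler_pdivrMl// mulr1 ler_nat.
lra.
Qed.

(** Bernoulli with exponent p/2 >= 1 for |f|^2 / N, whose mean is at least 1. *)
Lemma mean_powR_ge2 (p M : R) A e N : 2 <= p -> (0 < N)%N ->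
  admissible A e -> (N <= #|` A|)%N ->
  has_mean (fun t => cmod (dirichlet_poly A e t) `^ p) M -> N%:R `^ (p / 2) <= M.
Proof.
move=> p2 N0 [A0 e1] AN hM; have NR : 0 < N%:R :> R by rewrite ltr0n.
have q1 : 1 <= p / 2 by rewrite ler_pdivlMr// mul1r.
have h := has_meanZ (N%:R `^ (p / 2)) (has_meanD (has_mean_cst (1 - p / 2))
  (has_meanZ (p / 2 / N%:R) (mean_csq_dirichlet A0 e1))).
have := le_has_mean h hM => /(_ _)/(le_trans _); apply => [|t].
  rewrite ler_peMr ?powR_ge0//.
  have : p / 2 <= p / 2 / N%:R * #|` A|%:R.
    by rewrite -mulrA ler_peMr ?ler_pdivlMl ?mulr1 ?ler_nat//; lra.
  lra.
rewrite cmod_powR; set c := csq _.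
have c0 : 0 <= c / N%:R by rewrite divr_ge0 ?csq_ge0// ltW.
have {2}-> : c = N%:R * (c / N%:R) by rewrite mulrC mulfVK// gt_eqF.
rewrite powRM ?(ltW NR)// ler_wpM2l ?powR_ge0//.
apply: le_trans (powR_bernoulli_ge q1 c0).
rewrite le_eqVlt; apply/orP; left; apply/eqP; field; by rewrite gt_eqF.
Qed.

Lemma powR_split (y p q : R) : 0 <= y -> 0 < p -> p + q = 2 -> y `^ p * y `^ q = y ^+ 2.
Proof.
rewrite le_eqVlt => /predU1P[<- p0 _|y0 _ pq].
  by rewrite powR0 ?gt_eqF// mul0r expr0n.
by rewrite -powRD ?(gt_eqF y0) ?implybT// pq powR_mulrn// ltW.
Qed.

(** |f|^p <= N^(p-2) |f|^2, because |f| <= N. *)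
Lemma mean_powR_le_sup (p M : R) A e N : 2 <= p -> (0 < N)%N ->
  admissible A e -> (#|` A| <= N)%N ->
  has_mean (fun t => cmod (dirichlet_poly A e t) `^ p) M -> M <= N%:R `^ (p - 1).
Proof.
move=> p2 N0 [A0 e1] AN hM; have NR : 0 < N%:R :> R by rewrite ltr0n.
have h := has_meanZ (N%:R `^ (p - 2)) (mean_csq_dirichlet A0 e1).
have := le_has_mean hM h => /(_ _)/le_trans; apply => [t|].
  rewrite -sqr_cmod; set y := cmod _; have y0 : 0 <= y by exact: cmod_ge0.
  have [->|yn0] := eqVneq y 0; first by rewrite expr0n mulr0 powR0// gt_eqF; lra.
  have -> : p = (p - 2) + 2%:R by rewrite subrK.
  rewrite powRD ?yn0 ?implybT// powR_mulrn// addrK ler_wpM2r ?sqr_ge0//.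
  apply: ge0_ler_powR; rewrite ?nnegrE ?subr_ge0//.
  by apply: le_trans (cmod_dirichlet_le _ e1) _; rewrite ler_nat.
have -> : p - 1 = (p - 2) + 1 by ring.
rewrite (@powRD _ N%:R (p - 2) 1) ?(gt_eqF NR) ?implybT// powRr1 ?(ltW NR)//.
by rewrite ler_wpM2l ?powR_ge0// ler_nat.
Qed.

(** |f|^2 <= n^(2-p) |f|^p, because |f| <= n, the number of terms. *)
Lemma mean_powR_ge_sup (p M : R) A e N : 1 < p -> p <= 2 -> (0 < N)%N ->
  admissible A e -> (N <= #|` A|)%N ->
  has_mean (fun t => cmod (dirichlet_poly A e t) `^ p) M -> N%:R `^ (p - 1) <= M.
Proof.
move=> p1 p2 N0 [A0 e1] AN hM; have NR : 0 < N%:R :> R by rewrite ltr0n.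
pose n : R := #|` A|%:R.
have n0 : 0 < n by rewrite ltr0n; exact: leq_trans AN.
have p0 : 0 < p by lra.
have : n <= n `^ (2 - p) * M.
  apply: (le_has_mean (mean_csq_dirichlet A0 e1) (has_meanZ _ hM)) => t.
  rewrite -sqr_cmod -(@powR_split _ p (2 - p))// ?cmod_ge0//; last by ring.
  rewrite mulrC ler_wpM2r ?powR_ge0//.
  apply: ge0_ler_powR; rewrite ?nnegrE ?cmod_ge0 ?subr_ge0// ?(ltW n0)//.
  exact: cmod_dirichlet_le.
move=> h; apply: (@le_trans _ _ (n `^ (p - 1))).
  apply: ge0_ler_powR; rewrite ?nnegrE ?(ltW NR) ?(ltW n0)//; first lra.
  by rewrite ler_nat.
rewrite -(ler_pM2l (powR_gt0 (2 - p) n0)) -powRD ?(gt_eqF n0) ?implybT//.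
have -> : 2 - p + (p - 1) = 1 :> R by ring.
by rewrite powRr1 ?(ltW n0).
Qed.

(** The first term dominates where y <= K and the second where y >= K.  If one
of the two means is known to be small, a suitable K turns M(y^2) into a lower
bound for the other one. *)
Lemma sqr_le_split (y K p q : R) : 0 <= y -> 0 < K -> 0 < p -> p <= 2 -> 2 <= q ->
  y ^+ 2 <= K `^ (2 - p) * y `^ p + K `^ (2 - q) * y `^ q.
Proof.
move=> y0 K0 p0 p2 q2; have [yK|Ky] := lerP y K.
  rewrite -(@powR_split y p (2 - p))//; last by ring.
  apply: ler_wpDr; first by rewrite mulr_ge0 ?powR_ge0.
  rewrite mulrC ler_wpM2r ?powR_ge0//.
  by apply: ge0_ler_powR; rewrite ?nnegrE ?subr_ge0 ?(ltW K0).
apply: ler_wpDl; first by rewrite mulr_ge0 ?powR_ge0.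
have y1 : 0 < y by exact: lt_trans Ky.
rewrite -(@powR_split y q (2 - q))//; [|lra|by ring].
rewrite mulrC ler_wpM2r ?powR_ge0//.
have -> : 2 - q = - (q - 2) by ring.
rewrite !powRN lef_pV2 ?posrE ?powR_gt0//.
by apply: ge0_ler_powR; rewrite ?nnegrE ?subr_ge0 ?(ltW K0) ?(ltW Ky).
Qed.

(** * Lower bounds for the two extremal families *)

Lemma lac_dirichlet N : @lac R N = dirichlet_poly (pow2set (fun k => 3 ^ k)%N N) (fun=> 1).
Proof.
apply/funext => t; rewrite dirichlet_pow2set; last first.
  by move=> x y /eqP; rewrite eqn_exp2l// => /eqP.
by apply: eq_bigr => k _; rewrite mul1r.
Qed.

Lemma card_lac N : #|` pow2set (fun k => 3 ^ k)%N N| = N.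
Proof. by rewrite card_pow2set// => x y /eqP; rewrite eqn_exp2l// => /eqP. Qed.

Lemma mean_csq_lac N : has_mean (fun t => csq (@lac R N t)) N%:R.
Proof.
rewrite lac_dirichlet -{2}(card_lac N); apply: mean_csq_dirichlet.
  exact: pow2set0.
exact: unimodular1.
Qed.

(** [sqr_le_split] with exponents p and 4: the fourth moment is at most C N^2,
and K = k sqrt N with k^2 = 2 C leaves at least half of M(|f|^2) = N to the
p-th moment. *)
Lemma mean_lac_ge p : 0 < p -> p <= 2 -> exists2 C : R, 0 < C & forall N M, (0 < N)%N ->
  has_mean (fun t => cmod (@lac R N t) `^ p) M -> N%:R `^ (p / 2) <= C * M.
Proof.
move=> p0 p2.
have [C C0 HC] := @mean_lac_le R 4 (ltr0n _ 4).
pose k : R := Num.sqrt (2 * C).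
have k0 : 0 < k by rewrite sqrtr_gt0 mulr_gt0.
have k2 : k ^+ 2 = 2 * C by rewrite sqr_sqrtr// mulr_ge0// ltW.
exists (2 * k `^ (2 - p)); first by rewrite mulr_gt0// powR_gt0.
move=> N M N0 hM; have NR : 0 < N%:R :> R by rewrite ltr0n.
pose s : R := N%:R `^ 2^-1.
have s0 : 0 < s by rewrite powR_gt0.
have s2 : s ^+ 2 = N%:R by rewrite /s powR12_sqrt ?ltW// sqr_sqrtr// ltW.
have [M4 hM4] : exists M4, has_mean (fun t => cmod (@lac R N t) `^ 4) M4.
  by apply: has_mean_cmod_powR => //; rewrite lac_dirichlet; exact: trig_dirichlet.
have M4le := HC _ _ N0 hM4.
have ks0 : 0 < k * s by rewrite mulr_gt0.
have q2 : 2 <= 4 :> R by lra.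
have := le_has_mean (mean_csq_lac N) (has_meanD (has_meanZ ((k * s) `^ (2 - p)) hM)
  (has_meanZ ((k * s) `^ (2 - 4)) hM4)) => /(_ _).
have -> : (2 - 4 : R) = - 2%:R by ring.
rewrite powRN powR_mulrn ?(ltW ks0)// => H.
have {}H : N%:R <= (k * s) `^ (2 - p) * M + ((k * s) ^+ 2)^-1 * M4.
  apply: H => t; rewrite -sqr_cmod.
  have := @sqr_le_split (cmod (@lac R N t)) _ p 4 (cmod_ge0 _) ks0 p0 p2 q2.
  have -> : (2 - 4 : R) = - 2%:R by ring.
  by rewrite powRN (@powR_mulrn _ (k * s) 2) ?(ltW ks0).
have h4 : ((k * s) ^+ 2)^-1 * M4 <= N%:R / 2.
  rewrite exprMn k2 s2 ler_pdivrMl ?mulr_gt0//; apply: le_trans M4le _.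
  have -> : (4 / 2 : R) = 2%:R by field.
  rewrite powR_mulrn ?(ltW NR)//.
  by rewrite le_eqVlt; apply/orP; left; apply/eqP; field.
have h5 : N%:R / 2 <= (k * s) `^ (2 - p) * M by lra.
rewrite powRM ?(ltW k0) ?(ltW s0)// in h5.
have sp : N%:R `^ (p / 2) = s `^ p by rewrite /s -powRrM mulrC.
rewrite sp -(ler_pM2l (powR_gt0 (2 - p) s0)) [leLHS]mulrC powR_split ?(ltW s0)//; last by ring.
rewrite s2; lra.
Qed.

Lemma dker_dirichlet n : @dker R n = dirichlet_poly (pow2set id n) (fun=> 1).
Proof. by apply/funext => t; exact: dkerE. Qed.

(** [sqr_le_split] with exponents 3/2 and p: the moment of order 3/2 is at most
C N^(1/2), and K = k N with k^(1/2) = 1 / (2 C) leaves at least half of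
M(|D|^2) = N to the p-th moment. *)
Lemma mean_dker_ge p : 2 < p -> exists2 C : R, 0 < C & forall m M,
  has_mean (fun t => cmod (@dker R (2 ^ m) t) `^ p) M -> (2 ^+ m) `^ (p - 1) <= C * M.
Proof.
move=> p2; have q1 : 1 < 3 / 2 :> R by lra.
have [C C0 HC] := mean_dker_p q1.
pose k : R := (2 * C)^-1 ^+ 2.
have k0 : 0 < k by rewrite exprn_gt0// invr_gt0 mulr_gt0.
have kh : k `^ 2^-1 = (2 * C)^-1.
  by rewrite powR12_sqrt ?(ltW k0)// sqrtr_sqr ger0_norm// invr_ge0 mulr_ge0// ltW.
exists (2 * k `^ (2 - p)); first by rewrite mulr_gt0// powR_gt0.
move=> m M hM; pose n : R := 2 ^+ m.
have n0 : 0 < n by rewrite exprn_gt0.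
have kn0 : 0 < k * n by rewrite mulr_gt0.
have [M1 hM1] : exists M1, has_mean (fun t => cmod (@dker R (2 ^ m) t) `^ (3 / 2)) M1.
  apply: has_mean_cmod_powR; last lra.
  by rewrite dker_dirichlet; exact: trig_dirichlet.
have M1le := HC _ _ hM1.
have H : n <= (k * n) `^ (2 - 3 / 2) * M1 + (k * n) `^ (2 - p) * M.
  have h := mean_csq_dker R (2 ^ m); rewrite natrX in h.
  apply: (le_has_mean h (has_meanD (has_meanZ _ hM1) (has_meanZ _ hM))) => t.
  by rewrite -sqr_cmod; apply: sqr_le_split => //; rewrite ?cmod_ge0//; lra.
have h1 : (k * n) `^ (2 - 3 / 2) * M1 <= n / 2.
  have -> : 2 - 3 / 2 = 2^-1 :> R by field.
  rewrite powRM ?(ltW k0) ?(ltW n0)// kh.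
  have e1 : (3 / 2 - 1 : R) = 2^-1 by field.
  rewrite e1 in M1le.
  apply: (@le_trans _ _ ((2 * C)^-1 * n `^ 2^-1 * (C * n `^ 2^-1))).
    by rewrite ler_wpM2l// mulr_ge0 ?powR_ge0// invr_ge0 mulr_ge0// ltW.
  have -> : (2 * C)^-1 * n `^ 2^-1 * (C * n `^ 2^-1) = (n `^ 2^-1) ^+ 2 / 2.
    by field; rewrite gt_eqF.
  by rewrite powR12_sqrt ?(ltW n0)// sqr_sqrtr// ltW.
have h5 : n / 2 <= (k * n) `^ (2 - p) * M by lra.
rewrite powRM ?(ltW k0) ?(ltW n0)// in h5.
rewrite -/n -(ler_pM2l (powR_gt0 (2 - p) n0)) -powRD ?(gt_eqF n0) ?implybT//.
have -> : 2 - p + (p - 1) = 1 :> R by ring.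
rewrite powRr1 ?(ltW n0)//; lra.
Qed.

(** * The case p = 1 of the lower bound *)

(** Littlewood's inequality is applied to the complex conjugate, whose
frequencies ln n increase with n. *)
Lemma dirichlet_littlewood A e m M : admissible A e -> (blk m <= #|` A|)%N ->
  has_mean (fun t => cmod (dirichlet_poly A e t)) M -> m%:R <= 18 * M.
Proof.
move=> [A0 e1] mA hM.
pose s := sort leq (enum_fset A); pose n := size s.
have nA : n = #|` A| by rewrite /n size_sort.
have ss : sorted ltn s.
  rewrite ltn_sorted_uniq_leq sort_uniq fset_uniq/=; apply: sort_sorted; exact: leq_total.
have smem i : (i < n)%N -> nth 0%N s i \in A.
  by move=> lin; have := mem_nth 0%N lin; rewrite mem_sort.
have spos i : (i < n)%N -> (0 < nth 0 s i)%N.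
  by move=> /smem h; rewrite lt0n; apply: contraNneq A0 => <-.
have smono i j : (i < j)%N -> (j < n)%N -> (nth 0 s i < nth 0 s j)%N.
  move=> ij jn; apply: (sorted_ltn_nth ltn_trans 0%N ss) => //.
  by rewrite inE; exact: ltn_trans jn.
(* frequencies beyond the last element of A only serve to make l strictly
   increasing on all of nat *)
pose l i : R := if (i < n)%N then ln (nth 0 s i)%:R else ln (nth 0 s n.-1)%:R + i%:R.
pose a i : R[i] := if (i < n)%N then (e (nth 0%N s i))^* else 1.
have lmono i j : (i < j)%N -> l i < l j.
  move=> ij; rewrite /l; have [jn|jn] := ltnP j n.
    rewrite (ltn_trans ij jn) ltr_ln ?posrE ?ltr0n ?spos//; last exact: ltn_trans jn.
    by rewrite ltr_nat smono.
  have [lin|lin] := ltnP i n; last by rewrite ltrD2l ltr_nat.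
  apply: (@le_lt_trans _ _ (ln (nth 0 s n.-1)%:R)); last first.
    by rewrite ltrDl ltr0n; exact: leq_ltn_trans ij.
  have n0 : (0 < n)%N by exact: leq_ltn_trans lin.
  rewrite ler_ln ?posrE ?ltr0n ?spos ?ler_nat//; last by rewrite prednK.
  have [->//|ni] := eqVneq i n.-1.
  by apply/ltnW/smono; lia.
have a1 i : cmod (a i) = 1.
  rewrite /a; case: ifPn => [lin|_]; last exact: normc1.
  by rewrite cmod_conj e1// smem.
apply: (littlewood_lower_bound lmono a1 mA); rewrite -nA.
move: hM; congr has_mean; apply/funext => t; rewrite -[LHS]cmod_conj; congr (cmod _).
rewrite /dirichlet_poly -(perm_big _ (permEl (perm_sort leq (enum_fset A))))/= -/s.
rewrite (big_nth 0%N) -/n rmorph_sum /psum; apply: eq_big_nat => k /andP[_ kn].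
by rewrite /a /l kn nat_pow_mitE mulNr cisN rmorphM; congr (_ * _); exact: conjcK.
Qed.

(** As 4^m <= 3 n + 1 < 4^(m+1), the first m blocks fit into n frequencies and
ln n is at most (m + 1) ln 4. *)
Lemma Hnorm1_ge_ln N A e : (1 < N)%N -> admissible A e -> (N <= #|` A|)%N ->
  ln (N%:R : R) <= 36 * ln 4 * Hnorm 1%:E A e.
Proof.
move=> N1 Ae AN.
have [M hM] := @has_mean_dirichlet R 1 A e ltr01.
rewrite /= (has_mean_Hnorm_fin hM) invr1.
have M0 : 0 <= M.
  by apply: (le_has_mean (has_mean_cst 0) hM) => t; exact: powR_ge0.
rewrite powRr1//.
have {}hM : has_mean (fun t => cmod (dirichlet_poly A e t)) M.
  by move: hM; congr has_mean; apply/funext => t; rewrite powRr1// cmod_ge0.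
pose n := #|` A|; pose m := trunc_log 4 (3 * n).+1.
have /andP[m1 m2] : (4 ^ m <= (3 * n).+1 < 4 ^ m.+1)%N by exact: trunc_log_bounds.
have mn : (blk m <= n)%N by have := blkE m; lia.
have m0 : (0 < m)%N by rewrite trunc_log_gt0; lia.
have := dirichlet_littlewood Ae mn hM => mM.
have l4 : 0 < ln 4 :> R by rewrite ln_gt0// ltr1n.
apply: (@le_trans _ _ (m.+1%:R * ln 4)).
  have -> : m.+1%:R * ln 4 = ln ((4 ^ m.+1)%:R) :> R.
    by rewrite natrX lnXn// mulr_natl.
  rewrite ler_ln ?posrE ?ltr0n ?expn_gt0//; last by lia.
  by rewrite ler_nat; lia.
have : m.+1%:R <= 36 * M.
  rewrite -natr1; have : 1 <= m%:R :> R by rewrite ler1n.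
  lra.
by rewrite -(ler_pM2r l4) mulrAC.
Qed.

Lemma exists_pow2_ge N : (0 < N)%N -> exists m, (N <= 2 ^ m <= 2 * N)%N.
Proof.
case: N => // -[|N] _; first by exists 0%N.
exists (up_log 2 N.+2); have := @up_log_bounds 2 N.+2 isT isT.
have : (0 < up_log 2 N.+2)%N by rewrite up_log_gt0.
by case: (up_log _ _) => // k _ /=; rewrite expnS; lia.
Qed.

Lemma exists_pow2_le N : (0 < N)%N -> exists m, (2 ^ m <= N <= 2 * 2 ^ m)%N.
Proof.
move=> N0; exists (trunc_log 2 N); have /andP[-> h] := @trunc_log_bounds 2 N isT N0.
by rewrite -expnS ltnW.
Qed.

(** * The supremum norm *)

Lemma Hnorm_infty_ge A e t : unimodular_on A e ->
  cmod (dirichlet_poly A e t) <= Hnorm +oo%E A e.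
Proof.
move=> e1; apply: ub_le_sup; last by exists t.
by exists (#|` A|%:R) => _ [u _ <-]; exact: cmod_dirichlet_le.
Qed.

Lemma Hnorm_infty_le A e B : (forall t, cmod (dirichlet_poly A e t) <= B) ->
  Hnorm +oo%E A e <= B.
Proof.
move=> H; apply: ge_sup; first by exists (cmod (dirichlet_poly A e 0)), 0.
by move=> _ [t _ <-].
Qed.

Lemma Hnorm_infty_ge0 A e : admissible A e -> 0 <= Hnorm +oo%E A e.
Proof.
by move=> [_ e1]; apply: le_trans (Hnorm_infty_ge 0 e1); exact: cmod_ge0.
Qed.

Lemma Hnorm_infty1 A : 0%N \notin A -> Hnorm +oo%E A (fun=> 1) = #|` A|%:R :> R.
Proof.
move=> A0; apply/le_anti/andP; split.
  by apply: Hnorm_infty_le => t; apply: cmod_dirichlet_le; exact: unimodular1.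
apply: (@le_trans _ _ (cmod (dirichlet_poly A (fun=> 1) (0 : R)))); last first.
  exact: (Hnorm_infty_ge 0 (@unimodular1 R A)).
have -> : dirichlet_poly A (fun=> 1) 0 = #|` A|%:R :> R[i].
  rewrite /dirichlet_poly; under eq_bigr do rewrite mul1r nat_pow_mitE mulr0 cis0.
  by rewrite big_const_seq count_predT iter_addr_0.
by rewrite -[X in cmod X](rmorph_nat (real_complex R)) cmod_real ger0_norm.
Qed.

End Assembly.

(** * The democracy functions for each exponent *)

Section Cases.
Variable R : realType.
Implicit Types (A : {fset nat}) (e : nat -> R[i]).

Let natr_gt0 N : (0 < N)%N -> 0 < N%:R :> R. Proof. by rewrite ltr0n. Qed.

Lemma upper_democracy_le2 (p : R) : 1 <= p -> p <= 2 ->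
  approx_from 1 (phi_u R p%:E) (phi_uE R p%:E) /\
  approx_from 1 (phi_uE R p%:E) (fun N : nat => (N%:R : R) `^ (1 / 2)).
Proof.
move=> p1 p2; have p0 : 0 < p by lra.
have ep : 1 / 2 * p = p / 2 by ring.
have [C C0 HC] := mean_lac_ge p0 p2.
apply: (@upper_democracy _ _ _ _ (C `^ p^-1) 1) => //; first exact: powR_gt0.
  move=> N A e N0 Ae AN; have [M hM] := has_mean_dirichlet A e p0.
  have := Hnorm_fin_le p0 ltr01 (natr_gt0 N0) hM; rewrite powR1; apply.
  by rewrite ep mul1r; exact: mean_powR_le2 Ae AN hM.
move=> N N0; exists (pow2set (fun k => 3 ^ k)%N N).
split; [exact: pow2set0|by rewrite card_lac|].
have [M hM] := has_mean_dirichlet (pow2set (fun k => 3 ^ k)%N N) (fun=> 1) p0.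
apply: (Hnorm_fin_ge p0 C0 (natr_gt0 N0) hM); rewrite ep.
by rewrite -lac_dirichlet in hM; exact: HC N0 hM.
Qed.

Lemma lower_democracy_ge2 (p : R) : 2 <= p ->
  approx_from 1 (phi_l R p%:E) (phi_lE R p%:E) /\
  approx_from 1 (phi_lE R p%:E) (fun N : nat => (N%:R : R) `^ (1 / 2)).
Proof.
move=> p2; have p0 : 0 < p by lra.
have ep : 1 / 2 * p = p / 2 by ring.
have [C C0 HC] := mean_lac_le p0.
apply: (@lower_democracy _ _ _ _ 1 (C `^ p^-1)) => //; first exact: powR_gt0.
- by move=> A e _; exact: Hnorm_fin_ge0.
- move=> N A e N0 Ae AN; have [M hM] := has_mean_dirichlet A e p0.
  have := Hnorm_fin_ge p0 ltr01 (natr_gt0 N0) hM; rewrite powR1; apply.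
  by rewrite ep mul1r; exact: mean_powR_ge2 Ae AN hM.
move=> N N0; exists (pow2set (fun k => 3 ^ k)%N N).
split; [exact: pow2set0|by rewrite card_lac|].
have [M hM] := has_mean_dirichlet (pow2set (fun k => 3 ^ k)%N N) (fun=> 1) p0.
apply: (Hnorm_fin_le p0 C0 (natr_gt0 N0) hM); rewrite ep.
by rewrite -lac_dirichlet in hM; exact: HC N0 hM.
Qed.

Lemma lower_democracy_le2 (p : R) : 1 < p -> p <= 2 ->
  approx_from 1 (phi_l R p%:E) (phi_lE R p%:E) /\
  approx_from 1 (phi_lE R p%:E) (fun N : nat => (N%:R : R) `^ (1 - p^-1)).
Proof.
move=> p1 p2; have p0 : 0 < p by lra.
have ep : (1 - p^-1) * p = p - 1 by field; rewrite gt_eqF.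
have [C C0 HC] := mean_dker_p p1.
have D0 : 0 < C * 2 `^ (p - 1) by rewrite mulr_gt0// powR_gt0.
apply: (@lower_democracy _ _ _ _ 1 ((C * 2 `^ (p - 1)) `^ p^-1)) => //; first exact: powR_gt0.
- by move=> A e _; exact: Hnorm_fin_ge0.
- move=> N A e N0 Ae AN; have [M hM] := has_mean_dirichlet A e p0.
  have := Hnorm_fin_ge p0 ltr01 (natr_gt0 N0) hM; rewrite powR1; apply.
  by rewrite ep mul1r; exact: mean_powR_ge_sup p1 p2 N0 Ae AN hM.
move=> N N0; have [m /andP[m1 m2]] := exists_pow2_ge N0.
exists (pow2set id (2 ^ m)); split; [exact: pow2set0|by rewrite card_pow2set|].
have [M hM] := has_mean_dirichlet (pow2set id (2 ^ m)) (fun=> 1) p0.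
apply: (Hnorm_fin_le p0 D0 (natr_gt0 N0) hM); rewrite ep.
apply: (@le_trans _ _ (C * (2 ^+ m) `^ (p - 1))).
  by rewrite -dker_dirichlet in hM; exact: HC hM.
rewrite -mulrA ler_wpM2l ?(ltW C0)// -powRM//.
apply: ge0_ler_powR; rewrite ?nnegrE ?exprn_ge0 ?mulr_ge0//; first lra.
by rewrite -natrX -natrM ler_nat.
Qed.

Lemma upper_democracy_gt2 (p : R) : 2 < p ->
  approx_from 1 (phi_u R p%:E) (phi_uE R p%:E) /\
  approx_from 1 (phi_uE R p%:E) (fun N : nat => (N%:R : R) `^ (1 - p^-1)).
Proof.
move=> p2; have p0 : 0 < p by lra.
have ep : (1 - p^-1) * p = p - 1 by field; rewrite gt_eqF.
have [C C0 HC] := mean_dker_ge p2.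
have D0 : 0 < 2 `^ (p - 1) * C by rewrite mulr_gt0// powR_gt0.
apply: (@upper_democracy _ _ _ _ ((2 `^ (p - 1) * C) `^ p^-1) 1) => //; first exact: powR_gt0.
  move=> N A e N0 Ae AN; have [M hM] := has_mean_dirichlet A e p0.
  have := Hnorm_fin_le p0 ltr01 (natr_gt0 N0) hM; rewrite powR1; apply.
  by rewrite ep mul1r; exact: mean_powR_le_sup (ltW p2) N0 Ae AN hM.
move=> N N0; have [m /andP[m1 m2]] := exists_pow2_le N0.
exists (pow2set id (2 ^ m)); split; [exact: pow2set0|by rewrite card_pow2set|].
have [M hM] := has_mean_dirichlet (pow2set id (2 ^ m)) (fun=> 1) p0.
apply: (Hnorm_fin_ge p0 D0 (natr_gt0 N0) hM); rewrite ep.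
apply: (@le_trans _ _ (2 `^ (p - 1) * (2 ^+ m) `^ (p - 1))); last first.
  by rewrite -mulrA ler_wpM2l ?powR_ge0//; rewrite -dker_dirichlet in hM; exact: HC hM.
rewrite -powRM ?exprn_ge0//.
apply: ge0_ler_powR; rewrite ?nnegrE ?exprn_ge0 ?mulr_ge0 ?exprn_ge0//; first lra.
by rewrite -natrX -natrM ler_nat.
Qed.

Lemma lower_democracy_1 :
  approx_from 2 (phi_l R 1%:E) (phi_lE R 1%:E) /\
  approx_from 2 (phi_lE R 1%:E) (fun N : nat => ln (N%:R : R)).
Proof.
have l2 : 0 < ln 2 :> R by rewrite ln_gt0// ltr1n.
have l4 : 0 < ln 4 :> R by rewrite ln_gt0// ltr1n.
apply: (@lower_democracy _ _ _ _ (36 * ln 4) (96 / ln 2)).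
- by rewrite mulr_gt0.
- by rewrite divr_gt0.
- by move=> A e _; exact: Hnorm_fin_ge0.
- by move=> N A e; exact: Hnorm1_ge_ln.
move=> N N1; have N0 : (0 < N)%N by exact: ltnW.
have [m /andP[m1 m2]] := exists_pow2_ge N0.
exists (pow2set id (2 ^ m)); split; [exact: pow2set0|by rewrite card_pow2set|].
have [M hM] := has_mean_dirichlet (pow2set id (2 ^ m)) (fun=> 1) (@ltr01 R).
rewrite /= (has_mean_Hnorm_fin hM) invr1.
have M0 : 0 <= M.
  by apply: (le_has_mean (has_mean_cst 0) hM) => t; exact: powR_ge0.
rewrite powRr1//.
have : M <= 32 * m.+1%:R by rewrite -dker_dirichlet in hM; exact: mean_dker_p1 hM.
move=> /le_trans; apply.
rewrite mulrAC ler_pdivlMr// -natr1.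
have lnN : ln 2 <= ln N%:R :> R by rewrite ler_ln ?posrE ?natr_gt0// ler_nat.
have : m%:R * ln 2 <= ln 2 + ln N%:R :> R.
  rewrite mulr_natl -lnXn// -lnM ?posrE ?natr_gt0//.
  by rewrite ler_ln ?posrE ?exprn_gt0 ?mulr_gt0 ?natr_gt0// -natrX -natrM ler_nat.
nra.
Qed.

Lemma lower_superdemocracy_infty :
  approx_from 1 (phi_lE R +oo%E) (fun N : nat => (N%:R : R) `^ (1 / 2)).
Proof.
have sqrtE N : (N%:R : R) `^ (1 / 2) = Num.sqrt N%:R by rewrite div1r powR12_sqrt.
split.
  exists 2 => // N N0; have [m /andP[m1 m2]] := exists_pow2_ge N0.
  have [p [q [p1 _ Hpq]]] := rudin_shapiro R m.
  (* the coefficient of 2^k is the k-th Rudin-Shapiro coefficient *)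
  apply: (@phi_lE_le _ _ _ _ (pow2set id (2 ^ m)) (fun n => p (trunc_log 2 n))).
  - exact: Hnorm_infty_ge0.
  - by split; [exact: pow2set0|move=> n _; exact: p1].
  - by rewrite card_pow2set.
  apply: Hnorm_infty_le => t; rewrite dirichlet_pow2set//.
  under eq_bigr do rewrite trunc_expnK//.
  rewrite sqrtE; have -> : 2 * Num.sqrt N%:R = Num.sqrt (4 * N%:R) :> R.
    by rewrite sqrtrM// (_ : 4 = 2 ^+ 2 :> R) ?sqrtr_sqr ?ger0_norm// -natrX.
  rewrite cmodE ler_sqrt ?mulr_ge0//.
  have H := Hpq _ (cmod_z2 t).
  apply: (@le_trans _ _ (2 * 2 ^+ m)).
    by rewrite -H lerDl csq_ge0.
  have : ((2 ^ m)%:R <= (2 * N)%:R :> R) by rewrite ler_nat.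
  by rewrite natrX natrM; lra.
exists 1 => // N N0; rewrite [leRHS]mul1r; apply: phi_lE_ge => A e [A0 e1] AN.
rewrite sqrtE.
have h0 := Hnorm_infty_ge0 (conj A0 e1).
rewrite -(ger0_norm h0) -sqrtr_sqr ler_sqrt ?sqr_ge0//.
apply: (@le_trans _ _ #|` A|%:R); first by rewrite ler_nat.
apply: (le_has_mean (mean_csq_dirichlet A0 e1) (has_mean_cst _)) => t.
rewrite -sqr_cmod lerXn2r// ?nnegrE ?cmod_ge0//.
exact: Hnorm_infty_ge.
Qed.

Lemma lower_democracy_infty N : phi_l R +oo%E N = N%:R.
Proof.
apply/le_anti/andP; split.
  apply: (@phi_l_le _ _ _ _ (pow2set id N)).
  - exact: Hnorm_infty_ge0.
  - exact: pow2set0.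
  - by rewrite card_pow2set.
  - by rewrite (Hnorm_infty1 R (pow2set0 _ _)) card_pow2set.
apply: phi_l_ge => A A0 AN.
by rewrite (Hnorm_infty1 R A0) ler_nat.
Qed.

Lemma upper_democracy_infty N :
  phi_u R +oo%E N = phi_uE R +oo%E N /\ phi_uE R +oo%E N = N%:R.
Proof.
have HB A e : admissible A e -> (#|` A| <= N)%N -> Hnorm +oo%E A e <= N%:R :> R.
  move=> [A0 e1] AN; apply: Hnorm_infty_le => t.
  by apply: le_trans (cmod_dirichlet_le _ e1) _; rewrite ler_nat.
have h1 := phi_u_le_uE HB.
have h2 : phi_uE R +oo%E N <= N%:R by exact: phi_uE_le.
have h3 : N%:R <= phi_u R +oo%E N.
  apply: (phi_u_ge HB (pow2set0 id N)); first by rewrite card_pow2set.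
  by rewrite (Hnorm_infty1 R (pow2set0 _ _)) card_pow2set.
by split; apply/le_anti/andP; split => //; [exact: le_trans h3|exact: le_trans h1].
Qed.

End Cases.

Theorem theorem2p1 (R : realType) :
  [/\ (* p = 1 *)
      ((approx_from 2 (phi_l R 1%:E) (phi_lE R 1%:E) /\
        approx_from 2 (phi_lE R 1%:E) (fun N : nat => ln (N%:R : R))) /\
       (approx_from 1 (phi_u R 1%:E) (phi_uE R 1%:E) /\
        approx_from 1 (phi_uE R 1%:E) (fun N : nat => (N%:R : R) `^ (1 / 2)))),
      (* 1 < p < oo *)
      (forall p p' : R, 1 < p -> 1 / p + 1 / p' = 1 ->
       (approx_from 1 (phi_l R p%:E) (phi_lE R p%:E) /\
        approx_from 1 (phi_lE R p%:E)
          (fun N : nat => (N%:R : R) `^ Num.min (1 / 2) (1 / p'))) /\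
       (approx_from 1 (phi_u R p%:E) (phi_uE R p%:E) /\
        approx_from 1 (phi_uE R p%:E)
          (fun N : nat => (N%:R : R) `^ Num.max (1 / 2) (1 / p'))))
    & (* p = oo *)
      (((forall N : nat, (1 <= N)%N -> phi_l R +oo%E N = N%:R) /\
        approx_from 1 (phi_lE R +oo%E) (fun N : nat => (N%:R : R) `^ (1 / 2))) /\
       (forall N : nat, (1 <= N)%N ->
          phi_u R +oo%E N = phi_uE R +oo%E N /\
          phi_uE R +oo%E N = N%:R))].
Proof.
split.
- split; first exact: lower_democracy_1.
  by apply: upper_democracy_le2; lra.
- move=> p p' p1 pp'.
  have p0 : 0 < p by lra.
  have -> : 1 / p' = 1 - p^-1 by move: pp'; rewrite [1 / p]div1r; lra.
  have [p2|p2] := lerP p 2.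
    have h : 1 - p^-1 <= 1 / 2.
      have : 2^-1 <= p^-1 by rewrite lef_pV2 ?posrE.
      lra.
    rewrite (min_idPr h) (max_idPl h); split; first exact: lower_democracy_le2.
    exact: upper_democracy_le2 (ltW p1) p2.
  have h : 1 / 2 <= 1 - p^-1.
    have : p^-1 <= 2^-1 by rewrite lef_pV2 ?posrE// ltW.
    lra.
  rewrite (min_idPl h) (max_idPr h).
  by split; [exact: lower_democracy_ge2 (ltW p2)|exact: upper_democracy_gt2].
- split; last by move=> N _; exact: upper_democracy_infty.
  split; last exact: lower_superdemocracy_infty.
  by move=> N _; exact: lower_democracy_infty.
Qed.
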